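(* Let $\lambda>1$, $\lambda_j=\lambda^j$, $\nu,\mu>0$, $\theta=\frac{5-\delta}{2}$, and consider the system, for $j\ge1$ and with $a_0=b_0=0$, $$\frac{d}{dt}a_j=-\nu\lambda_j^2a_j-\lambda_j^\theta a_ja_{j+1}+\lambda_{j-1}^\theta a_{j-1}^2+\lambda_j^\theta b_jb_{j+1}-\lambda_{j-1}^\theta b_{j-1}^2,$$ $$\frac{d}{dt}b_j=-\mu\lambda_j^2b_j-\lambda_j^\theta a_jb_{j+1}+\lambda_j^\theta b_ja_{j+1}.$$ If $\delta\in[0,3]$, then for any initial data $(a^0,b^0)\in H^1\times H^1$ there exist $T>0$ and a strong solution $(a(t),b(t))$ of the system on $[0,T]$ with $(a(0),b(0))=(a^0,b^0)$. If $\delta\in[1,3]$, the strong solution is global, i.e. it is a strong solution on $[0,\infty)$.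
   Context: Sequences are real and indexed by $j\ge1$, $a(t)=(a_j(t))_{j\ge1}$, $b(t)=(b_j(t))_{j\ge1}$; the convention $a_0=b_0=0$ is used in the equations for $j=1$. $H=\ell^2$. For $s\in\mathbb R$, $\|u\|_s=(\sum_{n\ge1}\lambda_n^{2s}u_n^2)^{1/2}$ and $H^s$ is the space of sequences with $\|u\|_s<\infty$. A solution on an interval is a pair of $H$-valued functions $(a(t),b(t))$ whose components $a_j,b_j$ are $C^1$ on that interval and satisfy the system for all $j$. A solution is strong on $[T_1,T_2]$ if $\|a\|_1$ and $\|b\|_1$ are bounded on $[T_1,T_2]$; it is strong on $[T_1,\infty)$ if it is strong on $[T_1,T_2]$ for every $T_2>T_1$. *)

(* Defs.v *)
(* Stdlib reals with Coquelicot. *)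
From Stdlib Require Import Reals.
From Coquelicot Require Import Coquelicot.
Open Scope R_scope.

(* A real sequence (u_j) indexed by j >= 1; entry [n] holds u_{n+1}. *)
Definition sequence : Type := nat -> R.

(* u_j for j >= 1, together with the convention u_0 = 0. *)
Definition coord (u : sequence) (j : nat) : R :=
  match j with
  | O => 0
  | S n => u n
  end.

Definition lam (lambda : R) (j : nat) : R := lambda ^ j.

Definition in_H (u : sequence) : Prop :=
  ex_series (fun n => (coord u (S n)) ^ 2).

Definition norm_term (lambda s : R) (u : sequence) (n : nat) : R :=
  Rpower (lam lambda n) (2 * s) * (coord u n) ^ 2.

Definition in_Hs (lambda s : R) (u : sequence) : Prop :=
  ex_series (fun n => norm_term lambda s u (S n)).

(* Meaningful only when [in_Hs lambda s u] holds, [Series] being total. *)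
Definition norm_s (lambda s : R) (u : sequence) : R :=
  sqrt (Series (fun n => norm_term lambda s u (S n))).

Definition rhs_a (lambda nu theta : R) (a b : sequence) (j : nat) : R :=
  - nu * (lam lambda j) ^ 2 * coord a j
  - Rpower (lam lambda j) theta * coord a j * coord a (j + 1)
  + Rpower (lam lambda (j - 1)) theta * (coord a (j - 1)) ^ 2
  + Rpower (lam lambda j) theta * coord b j * coord b (j + 1)
  - Rpower (lam lambda (j - 1)) theta * (coord b (j - 1)) ^ 2.

Definition rhs_b (lambda mu theta : R) (a b : sequence) (j : nat) : R :=
  - mu * (lam lambda j) ^ 2 * coord b j
  - Rpower (lam lambda j) theta * coord a j * coord b (j + 1)
  + Rpower (lam lambda j) theta * coord b j * coord a (j + 1).

(* [f] is C^1 on [D] with derivative [df]; derivative and continuity are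
   relative to [D], hence one-sided at the endpoints of an interval. *)
Definition C1_on_with (D : R -> Prop) (f df : R -> R) : Prop :=
  forall t, D t -> D_in f df D t /\ continue_in df D t.

Definition Icc (T1 T2 : R) : R -> Prop := fun t => T1 <= t <= T2.
Definition Ici (T1 : R) : R -> Prop := fun t => T1 <= t.

Definition is_solution (lambda nu mu theta : R) (D : R -> Prop)
    (a b : R -> sequence) : Prop :=
  (forall t, D t -> in_H (a t) /\ in_H (b t)) /\
  (forall j, (1 <= j)%nat ->
     exists da db : R -> R,
       C1_on_with D (fun t => coord (a t) j) da /\
       C1_on_with D (fun t => coord (b t) j) db /\
       (forall t, D t ->
          da t = rhs_a lambda nu theta (a t) (b t) j /\
          db t = rhs_b lambda mu theta (a t) (b t) j)).

Definition bounded_in_Hs (lambda s : R) (D : R -> Prop)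
    (u : R -> sequence) : Prop :=
  exists M : R, forall t, D t ->
    in_Hs lambda s (u t) /\ norm_s lambda s (u t) <= M.

Definition strong_solution (lambda nu mu theta T1 T2 : R)
    (a b : R -> sequence) : Prop :=
  is_solution lambda nu mu theta (Icc T1 T2) a b /\
  bounded_in_Hs lambda 1 (Icc T1 T2) a /\
  bounded_in_Hs lambda 1 (Icc T1 T2) b.

Definition global_strong_solution (lambda nu mu theta T1 : R)
    (a b : R -> sequence) : Prop :=
  is_solution lambda nu mu theta (Ici T1) a b /\
  (forall T2, T1 < T2 -> strong_solution lambda nu mu theta T1 T2 a b).

(* Main.v *)
Require Import Defs.
From Stdlib Require Import Reals Lra Lia FunctionalExtensionality.
From Coquelicot Require Import Coquelicot.
Open Scope R_scope.

(* Clipping every entry of the nonlinearity at [M / lam j] makes it Lipschitz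
   for the weighted supremum norm [sup_j lam j |u_j|], with constants
   [O(lam j ^ (3/2))] in the [j]-th mode because [theta <= 5/2].  The dissipation
   [lam j ^ 2] absorbs this loss in Duhamel's formula, so Picard iteration with
   exponential weights in time solves the clipped system for all [t >= 0].
   Duhamel's formula also shows that the solution stays in [H^1], and that the
   clipping level is not reached before a time depending only on [M] when the
   data lie below [M - 1].

   When [theta <= 2], the nonlinear terms cancel in the energy up to a flux that
   vanishes in the limit, so [int |u|_1^2 dt] is bounded by the data.  The
   truncated [H^1] energies satisfy [S_N' <= A S_N S_(N+1)], whence by Gronwall
   a bound on them that depends neither on [M] nor on the time.  Choosing [M]
   above that bound, the clipping level is never reached. *)

(** * Linear equations with forcing *)

(** The quadratic terms cost up to [5/2] powers of [lam j], against [2] from the dissipation. In the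
    weighted supremum norm one factor stays of size [M / lam j], which lowers the cost to [3/2]. The
    remaining half power is used twice: to contract the Picard map in all modes at once, and to pass
    from a supremum bound to square summability. Clipping entry by entry keeps the nonlinearity
    local and Lipschitz on all sequences, so one pair exists on the half-line from the start; the
    local and the global claim concern this same pair and nothing is glued. The price is that
    clipping destroys the energy cancellation: the a priori bounds hold only where the clip is known
    to be inactive, which is what they should prove. Unit margins break the circle. An [H^1] energy
    at most [Q] gives weighted norms at most [Q + 1], the clip acts at [Q + 2], and crossing the gap
    takes a fixed time [tau], so steps of length [tau] can be chained forever. The Gronwall
    coefficient of [S_N] is [S_(N+1)], one level higher. The hierarchy need not close, because the
    time integral of the coefficient is bounded uniformly in [N]. *)

Lemma is_derive_continuity_pt (f : R -> R) (t l : R) :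
  is_derive f t l -> continuity_pt f t.
Proof.
  intros Hf; apply continuity_pt_filterlim.
  apply (ex_derive_continuous (K := R_AbsRing) (V := R_NormedModule) f t).
  now exists l.
Qed.

Lemma derive_le_increment_le (f h df dh : R -> R) (t0 t : R) :
  t0 <= t ->
  (forall s, t0 <= s <= t -> is_derive f s (df s)) ->
  (forall s, t0 <= s <= t -> is_derive h s (dh s)) ->
  (forall s, t0 <= s <= t -> df s <= dh s) ->
  f t - f t0 <= h t - h t0.
Proof.
  intros Ht Hf Hh Hle.
  assert (Hd : forall s, t0 <= s <= t ->
    is_derive (fun x => h x - f x) s (dh s - df s)).
  { intros s Hs; apply (is_derive_minus (K := R_AbsRing) (V := R_NormedModule));
    auto. }
  destruct (MVT_gen (fun x => h x - f x) t0 t (fun s => dh s - df s))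
    as [c [Hc Heq]];
    rewrite ?Rmin_left, ?Rmax_right in * by lra.
  - intros s Hs; apply Hd; lra.
  - intros s Hs; eapply is_derive_continuity_pt, Hd; lra.
  - specialize (Hle c Hc).
    assert (0 <= (dh c - df c) * (t - t0)) by (apply Rmult_le_pos; lra).
    lra.
Qed.

Lemma is_derive_RInt_continuous (g : R -> R) (t0 t : R) :
  continuity g -> is_derive (fun x => RInt g t0 x) t (g t).
Proof.
  intros Hg.
  assert (Hc : forall x, continuous g x)
    by (intros x; apply continuity_pt_filterlim, Hg).
  apply (is_derive_RInt g (fun x => RInt g t0 x) t0 t); [|apply Hc].
  exists (mkposreal 1 Rlt_0_1); intros y _.
  apply (RInt_correct (V := R_CompleteNormedModule)).
  apply (ex_RInt_continuous (V := R_CompleteNormedModule)); auto.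
Qed.

(** The factor [exp (- k * t)] stands outside the integral so that the integrand does not depend on
    [t]; differentiating is then the product rule and the fundamental theorem of calculus. *)
Definition duhamel (k c : R) (g : R -> R) (t : R) : R :=
  exp (- k * t) * (c + RInt (fun s => exp (k * s) * g s) 0 t).

Lemma duhamel_0 (k c : R) (g : R -> R) : duhamel k c g 0 = c.
Proof.
  unfold duhamel; rewrite RInt_point, Rmult_0_r, exp_0.
  change (@zero R_CompleteNormedModule) with 0; ring.
Qed.

Lemma exp_linear_continuity (k : R) : continuity (fun s => exp (k * s)).
Proof.
  intros s; eapply is_derive_continuity_pt; auto_derive; [exact I|reflexivity].
Qed.

Lemma duhamel_is_derive (k c : R) (g : R -> R) (t : R) :
  continuity g ->
  is_derive (duhamel k c g) t (- k * duhamel k c g t + g t).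
Proof.
  intros Hg; unfold duhamel.
  assert (HI := is_derive_RInt_continuous (fun s => exp (k * s) * g s) 0 t
    (continuity_mult _ _ (exp_linear_continuity k) Hg)).
  assert (HI1 : ex_derive (fun x => RInt (fun s => exp (k * s) * g s) 0 x) t)
    by (eexists; exact HI).
  assert (He : is_derive (fun x => exp (- k * x)) t (- k * exp (- k * t)))
    by (auto_derive; [exact I|ring]).
  assert (Hs : is_derive
    (fun x => c + RInt (fun s => exp (k * s) * g s) 0 x) t
    (0 + exp (k * t) * g t)).
  { apply (is_derive_plus (K := R_AbsRing) (V := R_NormedModule));
    [apply (is_derive_const (K := R_AbsRing) (V := R_NormedModule))|exact HI]. }
  assert (Hp := is_derive_mult _ _ _ _ _ He Hs Rmult_comm).
  eapply is_derive_ext; [|evar_last; [exact Hp|]].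
  - intros x; reflexivity.
  - unfold plus, mult; simpl.
    assert (exp (- k * t) * exp (k * t) = 1)
      by (rewrite <- exp_plus; replace (- k * t + k * t) with 0 by ring;
          apply exp_0).
    match goal with |- ?a * ?b + ?e * (0 + ?e' * ?g) = _ =>
      replace (a * b + e * (0 + e' * g)) with (a * b + (e * e') * g) by ring end.
    rewrite H; ring.
Qed.

(* The forcing bound may grow exponentially, so that the gain [/ (k + K)] is
   available even when [k] is small. *)
Lemma linear_ode_bound (k K m t0 t : R) (v g : R -> R) :
  0 <= m -> 0 < k + K -> t0 <= t ->
  (forall s, t0 <= s <= t -> is_derive v s (- k * v s + g s)) ->
  (forall s, t0 <= s <= t -> Rabs (g s) <= m * exp (K * (s - t0))) ->
  Rabs (v t) <= exp (- k * (t - t0)) * Rabs (v t0)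
                + m * exp (K * (t - t0)) / (k + K).
Proof.
  intros Hm HkK Ht Hv Hg.
  assert (one_sided : forall v' g' : R -> R,
    (forall s, t0 <= s <= t -> is_derive v' s (- k * v' s + g' s)) ->
    (forall s, t0 <= s <= t -> Rabs (g' s) <= m * exp (K * (s - t0))) ->
    v' t <= exp (- k * (t - t0)) * Rabs (v' t0)
            + m * exp (K * (t - t0)) / (k + K)).
  { intros v' g' Hv' Hg'.
    (* Integrating factor: [exp (k * (s - t0)) * v' s] grows at rate at most
       [m * exp ((k + K) * (s - t0))], whose primitive carries the gain [/ (k + K)]. *)
    assert (H := derive_le_increment_le
      (fun s => exp (k * (s - t0)) * v' s)
      (fun s => m / (k + K) * exp ((k + K) * (s - t0)))
      (fun s => exp (k * (s - t0)) * g' s)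
      (fun s => m * exp ((k + K) * (s - t0))) t0 t Ht).
    cbv beta in H.
    assert (H' : exp (k * (t - t0)) * v' t - exp (k * (t0 - t0)) * v' t0
      <= m / (k + K) * exp ((k + K) * (t - t0))
         - m / (k + K) * exp ((k + K) * (t0 - t0))).
    { apply H; intros s Hs.
      - assert (Hd := Hv' s Hs).
        assert (He : is_derive (fun x => exp (k * (x - t0))) s
          (k * exp (k * (s - t0)))) by (auto_derive; [exact I|unfold Rminus; ring]).
        assert (Hp := is_derive_mult _ _ _ _ _ He Hd Rmult_comm).
        evar_last; [exact Hp|]. unfold plus, mult; simpl; ring.
      - auto_derive; [exact I|]. unfold Rminus. field; lra.
      - specialize (Hg' s Hs). apply Rabs_le_between in Hg'.
        replace ((k + K) * (s - t0)) with (k * (s - t0) + K * (s - t0)) by ring.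
        rewrite exp_plus.
        assert (0 < exp (k * (s - t0))) by apply exp_pos.
        nra. }
    clear H. rewrite Rminus_diag, !Rmult_0_r, exp_0 in H'.
    replace ((k + K) * (t - t0)) with (k * (t - t0) + K * (t - t0)) in H' by ring.
    rewrite exp_plus in H'.
    assert (0 < m / (k + K) \/ m / (k + K) = 0) as Hq.
    { destruct Hm as [Hm|Hm]; [left; apply Rdiv_lt_0_compat; lra|].
      right; rewrite <- Hm; field; lra. }
    assert (Hinv : exp (- k * (t - t0)) * exp (k * (t - t0)) = 1).
    { rewrite <- exp_plus.
      replace (- k * (t - t0) + k * (t - t0)) with 0 by ring. apply exp_0. }
    assert (Hpos := exp_pos (- k * (t - t0))).
    assert (Habs := Rle_abs (v' t0)).
    replace (v' t) with (exp (- k * (t - t0)) * (exp (k * (t - t0)) * v' t))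
      by (rewrite <- Rmult_assoc, Hinv; ring).
    apply Rle_trans with (exp (- k * (t - t0)) *
      (Rabs (v' t0) + m / (k + K) * (exp (k * (t - t0)) * exp (K * (t - t0))))).
    - apply Rmult_le_compat_l; lra.
    - right. rewrite Rmult_plus_distr_l. f_equal.
      transitivity ((exp (- k * (t - t0)) * exp (k * (t - t0))) *
        (m / (k + K) * exp (K * (t - t0)))); [ring|].
      rewrite Hinv; field; lra. }
  apply Rabs_le; split; [|now apply one_sided with g].
  assert (H := one_sided (fun s => - v s) (fun s => - g s)).
  cbv beta in H. rewrite Rabs_Ropp in H.
  apply Ropp_le_cancel; rewrite Ropp_involutive; apply H.
  - intros s Hs. evar_last;
      [apply (is_derive_opp (K := R_AbsRing) (V := R_NormedModule)), Hv, Hs|].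
    unfold opp; simpl; ring.
  - intros s Hs; rewrite Rabs_Ropp; auto.
Qed.

Lemma Rmax_0_continuity : continuity (Rmax 0).
Proof.
  intros t0; apply continuity_pt_ext with (fun t => (t + Rabs t) / 2).
  - intros t; unfold Rmax, Rabs; destruct (Rle_dec 0 t), (Rcase_abs t); lra.
  - apply continuity_pt_mult; [|apply continuity_pt_const; now intros ? ?].
    apply continuity_pt_plus; [apply continuity_pt_id|apply Rcontinuity_abs].
Qed.

Lemma continuity_of_uniform_limit (f : nat -> R -> R) (u : R -> R) :
  (forall n, continuity (f n)) ->
  (forall t0 eps, 0 < eps ->
     exists n, forall t, Rabs (t - t0) < 1 -> Rabs (u t - f n t) <= eps) ->
  continuity u.
Proof.
  intros Hf Hlim t0 eps Heps.
  destruct (Hlim t0 (eps / 4)) as [n Hn]; [lra|].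
  destruct (Hf n t0 (eps / 4)) as [d [Hd Hcont]]; [lra|].
  exists (Rmin d 1); split; [apply Rmin_pos; lra|].
  intros t [HD Ht]. simpl in Ht |- *; unfold Rdist in *.
  assert (Hd1 := Rmin_l d 1); assert (Hd2 := Rmin_r d 1).
  assert (H1 := Hn t ltac:(lra)).
  assert (H2 := Hn t0 ltac:(rewrite Rminus_diag, Rabs_R0; lra)).
  assert (H3 : Rabs (f n t - f n t0) < eps / 4)
    by (apply (Hcont t); split; [exact HD|simpl; unfold Rdist; lra]).
  apply Rabs_le_between in H1, H2. apply Rabs_def2 in H3.
  apply Rabs_def1; lra.
Qed.

Lemma exp_le_exp (x y : R) : x <= y -> exp x <= exp y.
Proof.
  intros [H|H]; [left; now apply exp_increasing|right; now rewrite H].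
Qed.

Lemma div_pow_small (x A eps : R) : 1 < x -> 0 < eps -> exists n, A / x ^ n < eps.
Proof.
  intros Hx Heps.
  assert (Hx1 : / x < 1) by (rewrite <- Rinv_1; apply Rinv_lt_contravar; lra).
  assert (Hx0 : 0 < / x) by (apply Rinv_0_lt_compat; lra).
  destruct (pow_lt_1_zero (/ x) ltac:(rewrite Rabs_pos_eq; lra)
    (eps / (Rabs A + 1))) as [n Hn].
  { apply Rdiv_lt_0_compat; [lra|]. assert (H := Rabs_pos A); lra. }
  exists n. specialize (Hn n (le_n n)).
  assert (HA := Rabs_pos A). assert (HA' := Rle_abs A).
  rewrite Rabs_pos_eq, pow_inv in Hn by (apply pow_le; lra).
  assert (Hp := Rinv_0_lt_compat _ (pow_lt x n ltac:(lra))).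
  apply (Rmult_lt_compat_r (Rabs A + 1)) in Hn; [|lra].
  replace (eps / (Rabs A + 1) * (Rabs A + 1)) with eps in Hn by (field; lra).
  unfold Rdiv. nra.
Qed.

(** * Picard iteration in weighted supremum norms *)

Section Picard.

Context (I : Type) (k w Lip c : I -> R) (G : I -> (I -> R) -> R) (K B : R).

Context (k_pos : forall i, 0 < k i).
Context (w_pos : forall i, 0 < w i).
Context (K_ge0 : 0 <= K).
Context (B_ge0 : 0 <= B).
Context (Lip_ge0 : forall i, 0 <= Lip i).
Context (contraction : forall i, 2 * Lip i <= k i + K).
Context (G_lip : forall u v d, 0 <= d ->
  (forall i, w i * Rabs (u i - v i) <= d) ->
  forall i, w i * Rabs (G i u - G i v) <= Lip i * d).
Context (G_bounded : forall u i, w i * Rabs (G i u) <= Lip i * B).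
Context (G_continuity : forall f : I -> R -> R,
  (forall i, continuity (f i)) ->
  forall i, continuity (fun t => G i (fun i' => f i' t))).

(** The estimates hold for [t >= 0] only. Freezing negative times at 0 makes the forcing continuous
    on the whole line, so Duhamel's formula has a two-sided derivative at 0. *)
Definition forcing (f : I -> R -> R) (i : I) (t : R) : R :=
  G i (fun i' => f i' (Rmax 0 t)).

Definition picard_map (f : I -> R -> R) (i : I) : R -> R :=
  duhamel (k i) (c i) (forcing f i).

Definition continuous_from_0 (f : I -> R -> R) : Prop :=
  forall i, continuity (fun t => f i (Rmax 0 t)).

Lemma forcing_continuity f i : continuous_from_0 f -> continuity (forcing f i).
Proof.
  intros Hf; apply (G_continuity (fun i' t => f i' (Rmax 0 t)) Hf).
Qed.

Lemma duhamel_continuous_from_0 (g : I -> R -> R) :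
  (forall i, continuity (g i)) ->
  continuous_from_0 (fun i => duhamel (k i) (c i) (g i)).
Proof.
  intros Hg i t.
  apply (continuity_pt_comp (Rmax 0) (duhamel (k i) (c i) (g i)));
    [apply Rmax_0_continuity|].
  eapply is_derive_continuity_pt, duhamel_is_derive, Hg.
Qed.

Lemma picard_map_continuous f :
  continuous_from_0 f -> continuous_from_0 (picard_map f).
Proof.
  intros Hf; apply duhamel_continuous_from_0; intros i.
  now apply forcing_continuity.
Qed.

(** The gain [/ (k i + K)] meets the loss [Lip i], and [contraction] keeps their product at most
    [1/2] in every mode: damping serves where [k i] dominates [Lip i], the time weight [K]
    elsewhere. *)
Lemma duhamel_close (g h : I -> R -> R) (d : R) :
  0 <= d -> (forall i, continuity (g i)) -> (forall i, continuity (h i)) ->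
  (forall i t, 0 <= t ->
     w i * Rabs (g i t - h i t) <= Lip i * (d * exp (K * t))) ->
  forall i t, 0 <= t ->
    w i * Rabs (duhamel (k i) (c i) (g i) t - duhamel (k i) (c i) (h i) t)
    <= d / 2 * exp (K * t).
Proof.
  intros Hd Hg Hh Hgh i t Ht.
  assert (Hw := w_pos i); assert (HL := Lip_ge0 i); assert (Hk := k_pos i).
  assert (HC := contraction i). assert (HE := exp_pos (K * t)).
  assert (H := linear_ode_bound (k i) K (Lip i * d / w i) 0 t
    (fun s => duhamel (k i) (c i) (g i) s - duhamel (k i) (c i) (h i) s)
    (fun s => g i s - h i s)).
  cbv beta in H. rewrite !duhamel_0, Rminus_diag, Rabs_R0, !Rminus_0_r in H.
  assert (Hb : 0 <= Lip i * d / w i)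
    by (apply Rdiv_le_0_compat; [apply Rmult_le_pos|]; lra).
  apply Rle_trans with
    (w i * (Lip i * d / w i * exp (K * t) / (k i + K))).
  - apply Rmult_le_compat_l; [lra|]. rewrite Rmult_0_r, Rplus_0_l in H.
    apply H; try lra.
    + intros s Hs.
      evar_last; [apply (is_derive_minus (K := R_AbsRing) (V := R_NormedModule));
        apply duhamel_is_derive; auto|].
      unfold minus, plus, opp; simpl; ring.
    + intros s Hs. rewrite Rminus_0_r. apply Rmult_le_reg_l with (w i); [lra|].
      replace (w i * (Lip i * d / w i * exp (K * s)))
        with (Lip i * (d * exp (K * s))) by (field; lra).
      apply Hgh; lra.
  - replace (w i * (Lip i * d / w i * exp (K * t) / (k i + K)))
      with ((2 * Lip i) * (d * exp (K * t) / 2 / (k i + K))) by (field; lra).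
    replace (d / 2 * exp (K * t))
      with ((k i + K) * (d * exp (K * t) / 2 / (k i + K))) by (field; lra).
    apply Rmult_le_compat_r; [|lra].
    apply Rdiv_le_0_compat; [|lra]. apply Rdiv_le_0_compat; [|lra].
    apply Rmult_le_pos; lra.
Qed.

Lemma picard_map_contracts (f g : I -> R -> R) (d : R) :
  0 <= d -> continuous_from_0 f -> continuous_from_0 g ->
  (forall i t, 0 <= t -> w i * Rabs (f i t - g i t) <= d * exp (K * t)) ->
  forall i t, 0 <= t ->
    w i * Rabs (picard_map f i t - picard_map g i t) <= d / 2 * exp (K * t).
Proof.
  intros Hd Hf Hg Hfg i t Ht.
  apply (duhamel_close (forcing f) (forcing g)); auto;
    try (intros; now apply forcing_continuity).
  intros i' s Hs; unfold forcing; rewrite Rmax_right by lra.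
  apply G_lip; [|intros; apply Hfg; lra].
  apply Rmult_le_pos; [lra|]. left; apply exp_pos.
Qed.

(** Starting from the unforced solution makes the data [c] cancel in the first increment, which
    [G_bounded] then controls. *)
Fixpoint picard_iter (n : nat) : I -> R -> R :=
  match n with
  | O => fun i => duhamel (k i) (c i) (fun _ => 0)
  | S m => picard_map (picard_iter m)
  end.

Lemma picard_iter_continuous n : continuous_from_0 (picard_iter n).
Proof.
  induction n as [|n IH]; [|now apply picard_map_continuous].
  apply (duhamel_continuous_from_0 (fun _ _ => 0)).
  intros i t; apply continuity_pt_const; now intros ? ?.
Qed.

Lemma picard_iter_step n i t : 0 <= t ->
  w i * Rabs (picard_iter (S n) i t - picard_iter n i t)
  <= B / 2 ^ n * exp (K * t).
Proof.
  revert i t; induction n as [|n IH]; intros i t Ht.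
  - assert (HE : 1 <= exp (K * t)).
    { rewrite <- exp_0. apply exp_le_exp. apply Rmult_le_pos; lra. }
    apply Rle_trans with (B / 2 * exp (K * t)); [|simpl; nra].
    apply (duhamel_close (forcing (picard_iter 0)) (fun _ _ => 0)); auto.
    + intros; apply forcing_continuity, picard_iter_continuous.
    + intros i' s; apply continuity_pt_const; now intros ? ?.
    + intros i' s Hs. rewrite Rminus_0_r.
      apply Rle_trans with (Lip i' * B); [apply G_bounded|].
      apply Rmult_le_compat_l; [apply Lip_ge0|].
      assert (1 <= exp (K * s)).
      { rewrite <- exp_0. apply exp_le_exp. apply Rmult_le_pos; lra. }
      nra.
  - replace (B / 2 ^ S n) with (B / 2 ^ n / 2)
      by (simpl; field; apply pow_nonzero; lra).
    apply (picard_map_contracts (picard_iter (S n)) (picard_iter n));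
      auto using picard_iter_continuous.
    apply Rdiv_le_0_compat; [lra|]; apply pow_lt; lra.
Qed.

Lemma picard_iter_close n m i t : 0 <= t ->
  w i * Rabs (picard_iter (n + m) i t - picard_iter n i t)
  <= 2 * B / 2 ^ n * exp (K * t).
Proof.
  intros Ht.
  assert (HE := exp_pos (K * t)).
  (* The factor [1 - / 2 ^ m] gives the exact partial sum of the geometric series, a form that
     survives the induction on [m]. *)
  apply Rle_trans with (2 * B / 2 ^ n * (1 - / 2 ^ m) * exp (K * t)).
  - induction m as [|m IH].
    + rewrite Nat.add_0_r, Rminus_diag, Rabs_R0; simpl; lra.
    + rewrite Nat.add_succ_r.
      assert (H := picard_iter_step (n + m) i t Ht).
      assert (Hw := w_pos i).
      assert (Htri := Rabs_triang
        (picard_iter (S (n + m)) i t - picard_iter (n + m) i t)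
        (picard_iter (n + m) i t - picard_iter n i t)).
      replace (picard_iter (S (n + m)) i t - picard_iter (n + m) i t +
        (picard_iter (n + m) i t - picard_iter n i t))
        with (picard_iter (S (n + m)) i t - picard_iter n i t) in Htri by ring.
      apply Rle_trans with (B / 2 ^ (n + m) * exp (K * t) +
        2 * B / 2 ^ n * (1 - / 2 ^ m) * exp (K * t)); [nra|].
      right. rewrite pow_add. simpl. field. split; apply pow_nonzero; lra.
  - assert (H2 := pow_lt 2 n Rlt_0_2).
    assert (Hm := Rinv_0_lt_compat _ (pow_lt 2 m Rlt_0_2)).
    assert (0 <= 2 * B / 2 ^ n) by (apply Rdiv_le_0_compat; lra).
    apply Rmult_le_compat_r; [lra|]. nra.
Qed.

Lemma picard_iter_converges i t : 0 <= t ->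
  ex_finite_lim_seq (fun n => picard_iter n i t).
Proof.
  intros Ht; apply ex_lim_seq_cauchy_corr; intros eps.
  assert (Hw := w_pos i).
  destruct (div_pow_small 2 (2 * B * exp (K * t)) (w i * (eps / 2)) ltac:(lra)) as [N HN].
  { apply Rmult_lt_0_compat; [lra|]; assert (H := cond_pos eps); lra. }
  assert (Hclose : forall n, (N <= n)%nat ->
    Rabs (picard_iter n i t - picard_iter N i t) < eps / 2).
  { intros n Hn. apply Rmult_lt_reg_l with (w i); [lra|].
    eapply Rle_lt_trans; [|exact HN].
    replace n with (N + (n - N))%nat by lia.
    eapply Rle_trans; [now apply picard_iter_close|].
    right; field; apply pow_nonzero; lra. }
  exists N; intros n m Hn Hm.
  apply Hclose, Rabs_def2 in Hn. apply Hclose, Rabs_def2 in Hm.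
  apply Rabs_def1; lra.
Qed.

Definition picard_limit (i : I) (t : R) : R :=
  real (Lim_seq (fun n => picard_iter n i t)).

Lemma picard_limit_close n i t : 0 <= t ->
  w i * Rabs (picard_limit i t - picard_iter n i t)
  <= 2 * B / 2 ^ n * exp (K * t).
Proof.
  intros Ht. assert (Hw := w_pos i).
  assert (Hl := Lim_seq_correct' _ (picard_iter_converges i t Ht)).
  fold (picard_limit i t) in Hl.
  set (M := 2 * B / 2 ^ n * exp (K * t)).
  assert (Hb : forall m, Rabs (picard_iter (m + n) i t - picard_iter n i t) <= M / w i).
  { intros m; rewrite Nat.add_comm; apply Rmult_le_reg_l with (w i); [lra|].
    replace (w i * (M / w i)) with M by (field; lra).
    now apply picard_iter_close. }
  apply (is_lim_seq_incr_n _ n) in Hl.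
  apply Rle_trans with (w i * (M / w i)); [|right; field; lra].
  apply Rmult_le_compat_l; [lra|].
  apply (is_lim_seq_le (fun m => Rabs (picard_iter (m + n) i t - picard_iter n i t))
    (fun _ => M / w i) (Finite _) (Finite _) Hb); [|apply is_lim_seq_const].
  apply (is_lim_seq_abs _ (Finite _)).
  apply is_lim_seq_minus'; [exact Hl|apply is_lim_seq_const].
Qed.

Lemma picard_limit_continuous : continuous_from_0 picard_limit.
Proof.
  intros i.
  apply (continuity_of_uniform_limit (fun n t => picard_iter n i (Rmax 0 t))).
  - intros n; apply picard_iter_continuous.
  - intros t0 eps Heps. assert (Hw := w_pos i).
    destruct (div_pow_small 2 (2 * B * exp (K * (Rabs t0 + 1))) (w i * eps)
        ltac:(lra))
      as [n Hn]; [apply Rmult_lt_0_compat; lra|].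
    exists n; intros t Ht.
    assert (Hp := Rinv_0_lt_compat _ (pow_lt 2 n Rlt_0_2)).
    assert (0 <= Rmax 0 t <= Rabs t0 + 1).
    { split; [apply Rmax_l|]. apply Rmax_lub.
      - assert (H := Rabs_pos t0); lra.
      - apply Rabs_def2 in Ht; assert (H := Rle_abs t0); lra. }
    apply Rmult_le_reg_l with (w i); [lra|].
    eapply Rle_trans; [apply picard_limit_close; lra|].
    eapply Rle_trans; [|apply Rlt_le, Hn].
    replace (2 * B * exp (K * (Rabs t0 + 1)) / 2 ^ n)
      with (2 * B / 2 ^ n * exp (K * (Rabs t0 + 1)))
      by (field; apply pow_nonzero; lra).
    apply Rmult_le_compat_l.
    + apply Rdiv_le_0_compat; [lra|apply pow_lt; lra].
    + apply exp_le_exp; apply Rmult_le_compat_l; lra.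
Qed.

Lemma picard_limit_fixed i t : 0 <= t -> picard_map picard_limit i t = picard_limit i t.
Proof.
  intros Ht. assert (Hw := w_pos i).
  apply cond_eq; intros eps Heps.
  destruct (div_pow_small 2 (4 * B * exp (K * t)) (w i * eps) ltac:(lra)) as [n Hn];
    [apply Rmult_lt_0_compat; lra|].
  apply Rmult_lt_reg_l with (w i); [lra|]. eapply Rle_lt_trans; [|exact Hn].
  assert (Hp := pow_lt 2 n Rlt_0_2). assert (HE := exp_pos (K * t)).
  assert (H1 := picard_limit_close (S n) i t Ht).
  assert (H2 : w i * Rabs (picard_map picard_limit i t - picard_iter (S n) i t)
    <= 2 * B / 2 ^ n / 2 * exp (K * t)).
  { apply (picard_map_contracts picard_limit (picard_iter n));
      auto using picard_limit_continuous, picard_iter_continuous.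
    - apply Rdiv_le_0_compat; lra.
    - intros; now apply picard_limit_close. }
  assert (Htri := Rabs_triang
    (picard_map picard_limit i t - picard_iter (S n) i t)
    (picard_iter (S n) i t - picard_limit i t)).
  rewrite (Rabs_minus_sym (picard_iter (S n) i t)) in Htri.
  replace (picard_map picard_limit i t - picard_iter (S n) i t +
    (picard_iter (S n) i t - picard_limit i t))
    with (picard_map picard_limit i t - picard_limit i t) in Htri by ring.
  apply Rle_trans with (2 * B / 2 ^ n / 2 * exp (K * t) +
    2 * B / 2 ^ S n * exp (K * t)); [nra|].
  replace (4 * B * exp (K * t) / 2 ^ n) with (4 * (B / 2 ^ n * exp (K * t)))
    by (field; lra).
  replace (2 * B / 2 ^ n / 2 * exp (K * t) + 2 * B / 2 ^ S n * exp (K * t))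
    with (2 * (B / 2 ^ n * exp (K * t))) by (simpl; field; lra).
  assert (0 <= B / 2 ^ n * exp (K * t)); [|lra].
  apply Rmult_le_pos; [apply Rdiv_le_0_compat|]; lra.
Qed.

Lemma picard_existence :
  exists v : I -> R -> R,
    (forall i, v i 0 = c i) /\
    (forall i, continuity (v i)) /\
    (forall i t, 0 <= t ->
       is_derive (v i) t (- k i * v i t + G i (fun i' => v i' t))).
Proof.
  (* The image of the limit, not the limit itself: it is differentiable on the whole line by
     Duhamel's formula, and agrees with the limit for [t >= 0]. *)
  exists (picard_map picard_limit).
  assert (Hd : forall i t, is_derive (picard_map picard_limit i) t
    (- k i * picard_map picard_limit i t + forcing picard_limit i t)).
  { intros i t; apply duhamel_is_derive, forcing_continuity,
      picard_limit_continuous. }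
  split; [|split].
  - intros i; apply duhamel_0.
  - intros i t; eapply is_derive_continuity_pt, Hd.
  - intros i t Ht. evar_last; [apply Hd|].
    f_equal; unfold forcing; rewrite Rmax_right by lra.
    f_equal; apply functional_extensionality; intros i'.
    symmetry; now apply picard_limit_fixed.
Qed.

End Picard.

(** * The clipped nonlinearity *)

Definition clip (M x : R) : R := Rmax (- M) (Rmin x M).

Lemma clip_bound M x : 0 <= M -> Rabs (clip M x) <= M.
Proof.
  intros HM; apply Rabs_le; unfold clip, Rmax, Rmin.
  destruct (Rle_dec x M); destruct Rle_dec; lra.
Qed.

Lemma clip_id M x : Rabs x <= M -> clip M x = x.
Proof.
  intros H; apply Rabs_le_between in H; unfold clip, Rmax, Rmin.
  destruct (Rle_dec x M); destruct Rle_dec; lra.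
Qed.

Lemma clip_lipschitz M x y : Rabs (clip M x - clip M y) <= Rabs (x - y).
Proof.
  unfold clip, Rmax, Rmin, Rabs.
  destruct (Rle_dec x M), (Rle_dec y M); repeat destruct Rle_dec;
    repeat destruct Rcase_abs; lra.
Qed.

Lemma clip_continuity M : continuity (clip M).
Proof.
  intros x eps Heps; exists eps; split; [exact Heps|].
  intros y [_ Hy]; simpl in *; unfold Rdist in *.
  eapply Rle_lt_trans; [apply clip_lipschitz|exact Hy].
Qed.

(** With [x = rt lambda ^ j] the cubic is the nonlinear cost [lam j ^ (3/2)] and the quartic the
    dissipation [lam j ^ 2]. The constant [K] becomes the rate of the exponential time weight, and
    its inverse the length of a time step. The quartic wins beyond [x = A / c]. *)
Lemma cubic_le_quartic (A c : R) : 0 <= A -> 0 < c ->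
  exists K, 0 < K /\ forall x, 0 <= x -> A * x ^ 3 <= c * x ^ 4 + K.
Proof.
  intros HA Hc.
  assert (Hq : 0 <= A / c) by (apply Rdiv_le_0_compat; lra).
  exists (A * (A / c) ^ 3 + 1).
  assert (H3 : 0 <= A * (A / c) ^ 3)
    by (apply Rmult_le_pos; [lra|now apply pow_le]).
  split; [lra|]. intros x Hx.
  assert (H4 : 0 <= c * x ^ 4) by (apply Rmult_le_pos; [lra|now apply pow_le]).
  destruct (Rle_dec x (A / c)) as [Hle|Hgt].
  - assert (x ^ 3 <= (A / c) ^ 3) by (apply pow_incr; lra). nra.
  - assert (A <= c * x).
    { apply Rnot_le_lt in Hgt. apply (Rmult_lt_compat_l c) in Hgt; [|lra].
      replace (c * (A / c)) with A in Hgt by (field; lra). lra. }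
    assert (0 <= x ^ 3) by now apply pow_le.
    replace (c * x ^ 4) with (c * x * x ^ 3) by ring. nra.
Qed.

(** Half-integer powers of [lam lambda j] become integer powers of [rt lambda ^ j], so the exponents
    [3/2], [2], [5/2] are [3], [4], [5]. *)
Definition rt (lambda : R) : R := Rpower lambda (/ 2).

Definition wgt (lambda theta : R) (j : nat) : R := Rpower (lam lambda j) theta.

Lemma lam_pos lambda j : 1 < lambda -> 0 < lam lambda j.
Proof. intros H; apply pow_lt; lra. Qed.

Lemma lam_ge1 lambda j : 1 < lambda -> 1 <= lam lambda j.
Proof. intros H; apply pow_R1_Rle; lra. Qed.

Lemma lam_S lambda j : lam lambda (S j) = lambda * lam lambda j.
Proof. reflexivity. Qed.

Lemma rt_sqr lambda : 1 < lambda -> rt lambda ^ 2 = lambda.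
Proof.
  intros H; unfold rt. simpl; rewrite Rmult_1_r, <- Rpower_plus.
  replace (/ 2 + / 2) with 1 by field. apply Rpower_1; lra.
Qed.

Lemma rt_gt1 lambda : 1 < lambda -> 1 < rt lambda.
Proof.
  intros H; unfold rt. rewrite <- (Rpower_O lambda) by lra.
  apply Rpower_lt; lra.
Qed.

Lemma lam_rt lambda j : 1 < lambda -> lam lambda j = (rt lambda ^ j) ^ 2.
Proof.
  intros H; unfold lam. rewrite <- (rt_sqr lambda H) at 1.
  rewrite <- !pow_mult; f_equal; lia.
Qed.

Lemma lam_sqr_rt lambda j : 1 < lambda -> lam lambda j ^ 2 = (rt lambda ^ j) ^ 4.
Proof. intros H; rewrite (lam_rt _ _ H); ring. Qed.

Lemma wgt_pos lambda theta j : 0 < wgt lambda theta j.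
Proof. apply exp_pos. Qed.

(** The condition [delta >= 0] acts through this bound: [5/2] is the largest exponent considered,
    and later estimates see only the fifth power. *)
Lemma wgt_le_rt lambda theta j : 1 < lambda -> theta <= 5 / 2 ->
  wgt lambda theta j <= (rt lambda ^ j) ^ 5.
Proof.
  intros H Ht; unfold wgt.
  apply Rle_trans with (Rpower (lam lambda j) (5 / 2)).
  - apply Rle_Rpower; [now apply lam_ge1|exact Ht].
  - right. unfold lam, rt.
    rewrite <- pow_mult, <- !Rpower_pow by (try apply exp_pos; lra).
    rewrite !Rpower_mult, mult_INR. f_equal. simpl; field.
Qed.

Lemma wgt_le_lam lambda theta j : 1 < lambda -> theta <= 2 ->
  wgt lambda theta j <= lam lambda j ^ 2.
Proof.
  intros H Ht; unfold wgt.
  rewrite <- (Rpower_pow 2) by now apply lam_pos.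
  apply Rle_Rpower; [now apply lam_ge1|simpl; lra].
Qed.

(** Power count [1 + 5/2 - 1 - 1 = 3/2]; the factor [/ lambda] coming from [lam (S j)] is given
    away. *)
Lemma wgt_product_le lambda theta j : 1 < lambda -> theta <= 5 / 2 ->
  lam lambda j * (wgt lambda theta j * / lam lambda j * / lam lambda (S j))
  <= (rt lambda ^ j) ^ 3.
Proof.
  intros H Ht.
  assert (Hl := lam_pos lambda j H). assert (Hl' := lam_pos lambda (S j) H).
  assert (Hx := pow_lt _ j (Rlt_trans _ _ _ Rlt_0_1 (rt_gt1 lambda H))).
  assert (Hw := wgt_le_rt lambda theta j H Ht).
  assert (Hlr := lam_rt lambda j H).
  apply Rmult_le_reg_r with (lam lambda (S j)); [lra|].
  replace (lam lambda j * (wgt lambda theta j * / lam lambda j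
    * / lam lambda (S j)) * lam lambda (S j)) with (wgt lambda theta j)
    by (field; lra).
  eapply Rle_trans; [exact Hw|]. rewrite (lam_S lambda j).
  assert (0 < (rt lambda ^ j) ^ 3) by now apply pow_lt.
  replace ((rt lambda ^ j) ^ 5) with ((rt lambda ^ j) ^ 3 * lam lambda j)
    by (rewrite Hlr; ring).
  rewrite <- Rmult_assoc, (Rmult_comm _ lambda), Rmult_assoc.
  assert (0 < (rt lambda ^ j) ^ 3 * lam lambda j)
    by now apply Rmult_lt_0_compat.
  nra.
Qed.

(** Here mode [j] feeds mode [S j], whose weight is larger by [lambda]. The left side is at most
    [lambda * lam j ^ (3/2)], while the right side equals [lambda ^ (3/2) * lam j ^ (3/2)]. *)
Lemma wgt_pred_product_le lambda theta j : 1 < lambda -> theta <= 5 / 2 ->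
  lam lambda (S j) * (wgt lambda theta j * / lam lambda j * / lam lambda j)
  <= (rt lambda ^ S j) ^ 3.
Proof.
  intros H Ht.
  assert (Hl := lam_pos lambda j H).
  assert (Hr := rt_gt1 lambda H).
  assert (Hx := pow_lt _ j (Rlt_trans _ _ _ Rlt_0_1 Hr)).
  assert (Hw := wgt_le_rt lambda theta j H Ht).
  assert (Hlr := lam_rt lambda j H).
  apply Rle_trans with (lam lambda (S j) *
    ((rt lambda ^ j) ^ 5 * / lam lambda j * / lam lambda j)).
  - apply Rmult_le_compat_l; [left; now apply lam_pos|].
    apply Rmult_le_compat_r; [left; now apply Rinv_0_lt_compat|].
    apply Rmult_le_compat_r; [left; now apply Rinv_0_lt_compat|]. exact Hw.
  - rewrite (lam_S lambda j), Hlr. rewrite <- (rt_sqr lambda H) at 1. simpl (_ ^ S j).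
    replace (rt lambda ^ 2 * (rt lambda ^ j) ^ 2 *
      ((rt lambda ^ j) ^ 5 * / (rt lambda ^ j) ^ 2 * / (rt lambda ^ j) ^ 2))
      with (rt lambda ^ 2 * (rt lambda ^ j) ^ 3) by (field; lra).
    replace ((rt lambda * rt lambda ^ j) ^ 3)
      with (rt lambda * (rt lambda ^ 2 * (rt lambda ^ j) ^ 3)) by ring.
    assert (0 < rt lambda ^ 2 * (rt lambda ^ j) ^ 3)
      by (apply Rmult_lt_0_compat; apply pow_lt; lra).
    nra.
Qed.

(** Squares are written as products of two coordinates, so that every term has the shape [W * p * q]
    of one common difference estimate. *)
Definition nonlin_a (lambda theta : R) (a b : sequence) (j : nat) : R :=
  - (wgt lambda theta j * coord a j * coord a (S j))
  + wgt lambda theta (j - 1) * coord a (j - 1) * coord a (j - 1)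
  + wgt lambda theta j * coord b j * coord b (S j)
  - wgt lambda theta (j - 1) * coord b (j - 1) * coord b (j - 1).

Definition nonlin_b (lambda theta : R) (a b : sequence) (j : nat) : R :=
  - (wgt lambda theta j * coord a j * coord b (S j))
  + wgt lambda theta j * coord b j * coord a (S j).

Lemma rhs_a_nonlin lambda nu theta a b j :
  rhs_a lambda nu theta a b j =
  - (nu * lam lambda j ^ 2) * coord a j + nonlin_a lambda theta a b j.
Proof. unfold rhs_a, nonlin_a, wgt; rewrite Nat.add_1_r; ring. Qed.

Lemma rhs_b_nonlin lambda mu theta a b j :
  rhs_b lambda mu theta a b j =
  - (mu * lam lambda j ^ 2) * coord b j + nonlin_b lambda theta a b j.
Proof. unfold rhs_b, nonlin_b, wgt; rewrite Nat.add_1_r; ring. Qed.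

Definition weighted_bound (lambda M : R) (u : sequence) : Prop :=
  forall j, Rabs (coord u j) <= M * / lam lambda j.

Definition weighted_dist_le (lambda d : R) (u v : sequence) : Prop :=
  forall j, Rabs (coord u j - coord v j) <= d * / lam lambda j.

(** Rests on [p q - p' q' = p (q - q') + (p - p') q'], whence size bounds on [p] and [q'] and the
    factor 2. *)
Lemma product_difference (W p q p' q' P Q M d C : R) :
  0 <= W ->
  Rabs p <= M * P -> Rabs q' <= M * Q ->
  Rabs (p - p') <= d * P -> Rabs (q - q') <= d * Q ->
  0 <= M -> 0 <= d -> W * P * Q <= C ->
  Rabs (W * p * q - W * p' * q') <= 2 * M * d * C.
Proof.
  intros HW Hp Hq Hpp Hqq HM Hd HC.
  replace (W * p * q - W * p' * q')
    with (W * (p * (q - q') + (p - p') * q')) by ring.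
  rewrite Rabs_mult, (Rabs_pos_eq W) by exact HW.
  assert (H1 : Rabs (p * (q - q')) <= M * P * (d * Q)).
  { rewrite Rabs_mult; apply Rmult_le_compat; auto using Rabs_pos. }
  assert (H2 : Rabs ((p - p') * q') <= d * P * (M * Q)).
  { rewrite Rabs_mult; apply Rmult_le_compat; auto using Rabs_pos. }
  assert (H3 := Rabs_triang (p * (q - q')) ((p - p') * q')).
  apply Rle_trans with (W * (2 * M * d * (P * Q))).
  - apply Rmult_le_compat_l; [exact HW|]. lra.
  - replace (W * (2 * M * d * (P * Q))) with (2 * M * d * (W * P * Q)) by ring.
    apply Rmult_le_compat_l; [|exact HC].
    apply Rmult_le_pos; lra.
Qed.

Section NonlinearityEstimates.

Context (lambda theta M d : R).
Context (lambda_gt1 : 1 < lambda).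
Context (theta_le : theta <= 5 / 2).
Context (M_ge0 : 0 <= M).
Context (d_ge0 : 0 <= d).

Lemma scaled_product_difference j i i' (u v u' v' : sequence) W :
  0 <= W ->
  lam lambda j * (W * / lam lambda i * / lam lambda i') <= (rt lambda ^ j) ^ 3 ->
  weighted_bound lambda M u -> weighted_bound lambda M v' ->
  weighted_dist_le lambda d u u' -> weighted_dist_le lambda d v v' ->
  Rabs (W * coord u i * coord v i' - W * coord u' i * coord v' i')
  <= 2 * M * d * ((rt lambda ^ j) ^ 3 * / lam lambda j).
Proof.
  intros HW HC Hu Hv Hd1 Hd2.
  apply product_difference with (P := / lam lambda i) (Q := / lam lambda i');
    auto.
  assert (Hl := lam_pos lambda j lambda_gt1).
  apply Rmult_le_reg_l with (lam lambda j); [exact Hl|].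
  eapply Rle_trans; [exact HC|]. right; field; lra.
Qed.

(** The constant [8 * M] counts at most four products, each contributing [2 * M]. *)
Lemma nonlin_lipschitz a b a' b' j :
  (1 <= j)%nat ->
  weighted_bound lambda M a -> weighted_bound lambda M b ->
  weighted_bound lambda M a' -> weighted_bound lambda M b' ->
  weighted_dist_le lambda d a a' -> weighted_dist_le lambda d b b' ->
  lam lambda j * Rabs (nonlin_a lambda theta a b j - nonlin_a lambda theta a' b' j)
    <= 8 * M * (rt lambda ^ j) ^ 3 * d /\
  lam lambda j * Rabs (nonlin_b lambda theta a b j - nonlin_b lambda theta a' b' j)
    <= 8 * M * (rt lambda ^ j) ^ 3 * d.
Proof.
  intros Hj Ha Hb Ha' Hb' Hda Hdb.
  assert (Hl := lam_pos lambda j lambda_gt1).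
  assert (Hw := Rlt_le _ _ (wgt_pos lambda theta j)).
  assert (Hw' := Rlt_le _ _ (wgt_pos lambda theta (j - 1))).
  assert (HC := wgt_product_le lambda theta j lambda_gt1 theta_le).
  assert (HC' := wgt_pred_product_le lambda theta (j - 1) lambda_gt1 theta_le).
  replace (S (j - 1)) with j in HC' by lia.
  set (X := (rt lambda ^ j) ^ 3) in *.
  assert (HX : 0 <= 2 * M * d * (X * / lam lambda j)).
  { assert (0 <= X).
    { apply pow_le, pow_le; assert (H := rt_gt1 lambda lambda_gt1); lra. }
    apply Rmult_le_pos; [nra|].
    apply Rmult_le_pos; [lra|left; now apply Rinv_0_lt_compat]. }
  assert (Hfin : forall z, Rabs z <= 4 * (2 * M * d * (X * / lam lambda j)) ->
    lam lambda j * Rabs z <= 8 * M * X * d).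
  { intros z Hz. apply (Rmult_le_compat_l (lam lambda j)) in Hz; [|lra].
    eapply Rle_trans; [exact Hz|]. right; field; lra. }
  split; apply Hfin; unfold nonlin_a, nonlin_b.
  - assert (H1 := scaled_product_difference j j (S j) a a a' a' _ Hw HC Ha Ha' Hda Hda).
    assert (H2 := scaled_product_difference j j (S j) b b b' b' _ Hw HC Hb Hb' Hdb Hdb).
    assert (H3 := scaled_product_difference j _ _ a a a' a' _ Hw' HC' Ha Ha' Hda Hda).
    assert (H4 := scaled_product_difference j _ _ b b b' b' _ Hw' HC' Hb Hb' Hdb Hdb).
    fold X in H1, H2, H3, H4.
    apply Rabs_le_between in H1, H2, H3, H4. apply Rabs_le; lra.
  - assert (H1 := scaled_product_difference j j (S j) a b a' b' _ Hw HC Ha Hb' Hda Hdb).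
    assert (H2 := scaled_product_difference j j (S j) b a b' a' _ Hw HC Hb Ha' Hdb Hda).
    fold X in H1, H2.
    apply Rabs_le_between in H1, H2. apply Rabs_le; lra.
Qed.

End NonlinearityEstimates.

Definition trunc (lambda M : R) (u : sequence) : sequence :=
  fun n => clip (M / lam lambda (S n)) (u n).

Lemma coord_trunc lambda M u j :
  coord (trunc lambda M u) (S j) = clip (M / lam lambda (S j)) (coord u (S j)).
Proof. reflexivity. Qed.

Lemma weighted_bound_trunc lambda M u : 1 < lambda -> 0 <= M ->
  weighted_bound lambda M (trunc lambda M u).
Proof.
  intros Hl HM j.
  assert (0 <= M / lam lambda j)
    by (apply Rdiv_le_0_compat; [lra|now apply lam_pos]).
  destruct j as [|j]; [simpl (coord _ 0); rewrite Rabs_R0; exact H|].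
  rewrite coord_trunc. now apply clip_bound.
Qed.

Lemma trunc_id lambda M u :
  weighted_bound lambda M u -> trunc lambda M u = u.
Proof.
  intros Hu; apply functional_extensionality; intros n.
  apply clip_id, (Hu (S n)).
Qed.

Lemma trunc_dist lambda M d u v :
  weighted_dist_le lambda d u v ->
  weighted_dist_le lambda d (trunc lambda M u) (trunc lambda M v).
Proof.
  intros H [|j]; [exact (H 0%nat)|].
  rewrite !coord_trunc. eapply Rle_trans; [apply clip_lipschitz|apply H].
Qed.

(** The Lipschitz estimate against the zero sequence, which lies at weighted distance at most [M]
    from any clipped one. It gives the bound on the forcing that is used both for the first Picard
    increment and in the Duhamel estimates. *)
Lemma nonlin_trunc_bounded lambda theta M u v j :
  1 < lambda -> theta <= 5 / 2 -> 0 <= M -> (1 <= j)%nat ->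
  lam lambda j * Rabs (nonlin_a lambda theta (trunc lambda M u) (trunc lambda M v) j)
    <= 8 * M * (rt lambda ^ j) ^ 3 * M /\
  lam lambda j * Rabs (nonlin_b lambda theta (trunc lambda M u) (trunc lambda M v) j)
    <= 8 * M * (rt lambda ^ j) ^ 3 * M.
Proof.
  intros Hl Ht HM Hj.
  assert (Hu := weighted_bound_trunc lambda M u Hl HM).
  assert (Hv := weighted_bound_trunc lambda M v Hl HM).
  assert (Hc0 : forall i, coord (fun _ => 0) i = 0) by (intros [|i]; reflexivity).
  assert (H0 : weighted_bound lambda M (fun _ => 0)).
  { intros i; rewrite Hc0, Rabs_R0.
    apply Rmult_le_pos; [lra|left; now apply Rinv_0_lt_compat, lam_pos]. }
  assert (Hd0 : forall w, weighted_bound lambda M w ->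
    weighted_dist_le lambda M w (fun _ => 0)).
  { intros w Hw i; rewrite Hc0, Rminus_0_r; apply Hw. }
  assert (H := nonlin_lipschitz lambda theta M M Hl Ht HM HM _ _ _ _ j Hj
    Hu Hv H0 H0 (Hd0 _ Hu) (Hd0 _ Hv)).
  assert (Ha0 : nonlin_a lambda theta (fun _ => 0) (fun _ => 0) j = 0)
    by (unfold nonlin_a; rewrite !Hc0; ring).
  assert (Hb0 : nonlin_b lambda theta (fun _ => 0) (fun _ => 0) j = 0)
    by (unfold nonlin_b; rewrite !Hc0; ring).
  now rewrite Ha0, Hb0, !Rminus_0_r in H.
Qed.

(** * Solutions of the clipped system *)

Definition coords_continuous (u : R -> sequence) : Prop :=
  forall j, continuity (fun t => coord (u t) j).

Lemma coords_continuous_of_entries (u : R -> sequence) :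
  (forall n, continuity (fun t => u t n)) -> coords_continuous u.
Proof.
  intros Hu [|n]; [|exact (Hu n)].
  intros t; apply continuity_pt_const; now intros ? ?.
Qed.

Lemma trunc_continuous lambda M u :
  coords_continuous u -> coords_continuous (fun t => trunc lambda M (u t)).
Proof.
  intros Hu; apply coords_continuous_of_entries; intros n t.
  apply (continuity_pt_comp (fun t => u t n) (clip (M / lam lambda (S n))));
    [apply (Hu (S n))|apply clip_continuity].
Qed.

Lemma scaled_product_continuity W f g :
  continuity f -> continuity g -> continuity (fun t => W * f t * g t).
Proof.
  intros Hf Hg t.
  apply (continuity_pt_mult (fun t => W * f t) g); [|apply Hg].
  apply (continuity_pt_scal f W), Hf.
Qed.

Lemma nonlin_a_continuity lambda theta a b j :
  coords_continuous a -> coords_continuous b ->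
  continuity (fun t => nonlin_a lambda theta (a t) (b t) j).
Proof.
  intros Ha Hb t; unfold nonlin_a.
  apply (continuity_pt_minus
    (fun t => - (wgt lambda theta j * coord (a t) j * coord (a t) (S j))
      + wgt lambda theta (j - 1) * coord (a t) (j - 1) * coord (a t) (j - 1)
      + wgt lambda theta j * coord (b t) j * coord (b t) (S j)));
    [|now apply scaled_product_continuity].
  apply (continuity_pt_plus
    (fun t => - (wgt lambda theta j * coord (a t) j * coord (a t) (S j))
      + wgt lambda theta (j - 1) * coord (a t) (j - 1) * coord (a t) (j - 1)));
    [|now apply scaled_product_continuity].
  apply (continuity_pt_plus
    (fun t => - (wgt lambda theta j * coord (a t) j * coord (a t) (S j))));
    [|now apply scaled_product_continuity].
  apply (continuity_pt_opp
    (fun t => wgt lambda theta j * coord (a t) j * coord (a t) (S j))).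
  now apply scaled_product_continuity.
Qed.

Lemma nonlin_b_continuity lambda theta a b j :
  coords_continuous a -> coords_continuous b ->
  continuity (fun t => nonlin_b lambda theta (a t) (b t) j).
Proof.
  intros Ha Hb t; unfold nonlin_b.
  apply (continuity_pt_plus
    (fun t => - (wgt lambda theta j * coord (a t) j * coord (b t) (S j))));
    [|now apply scaled_product_continuity].
  apply (continuity_pt_opp
    (fun t => wgt lambda theta j * coord (a t) j * coord (b t) (S j))).
  now apply scaled_product_continuity.
Qed.

(* Differentiable at every [t >= 0] from both sides: the solution is
   constructed on the whole line, the equation being imposed for [t >= 0]. *)
Definition truncated_solution (lambda nu mu theta M : R)
    (a b : R -> sequence) : Prop :=
  coords_continuous a /\ coords_continuous b /\
  forall j t, (1 <= j)%nat -> 0 <= t ->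
    is_derive (fun s => coord (a s) j) t
      (- (nu * lam lambda j ^ 2) * coord (a t) j
       + nonlin_a lambda theta (trunc lambda M (a t)) (trunc lambda M (b t)) j) /\
    is_derive (fun s => coord (b s) j) t
      (- (mu * lam lambda j ^ 2) * coord (b t) j
       + nonlin_b lambda theta (trunc lambda M (a t)) (trunc lambda M (b t)) j).

(** Both sequences form one family, [true] marking [a] and [false] marking [b], so that the
    scalar-indexed Picard scheme treats the coupled system. Index [n] stands for mode [S n]. *)
Definition trunc_nonlin (lambda theta M : R) (i : bool * nat)
    (v : bool * nat -> R) : R :=
  (if fst i then nonlin_a lambda theta else nonlin_b lambda theta)
    (trunc lambda M (fun n => v (true, n)))
    (trunc lambda M (fun n => v (false, n))) (S (snd i)).

Lemma truncated_solution_exists lambda nu mu theta M (a0 b0 : sequence) :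
  1 < lambda -> 0 < nu -> 0 < mu -> theta <= 5 / 2 -> 0 <= M ->
  exists a b, truncated_solution lambda nu mu theta M a b /\ a 0 = a0 /\ b 0 = b0.
Proof.
  intros Hl Hnu Hmu Ht HM.
  set (c := Rmin nu mu).
  assert (Hc : 0 < c) by now apply Rmin_pos.
  (* [16 * M] is twice the Lipschitz constant [8 * M], as [contraction] requires. *)
  destruct (cubic_le_quartic (16 * M) c) as [K [HK Hcub]]; [lra|exact Hc|].
  assert (Hr := rt_gt1 lambda Hl).
  assert (Hx : forall j, 0 < rt lambda ^ j) by (intros; apply pow_lt; lra).
  destruct (picard_existence (bool * nat)
    (fun i => (if fst i then nu else mu) * lam lambda (S (snd i)) ^ 2)
    (fun i => lam lambda (S (snd i)))
    (fun i => 8 * M * (rt lambda ^ S (snd i)) ^ 3)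
    (fun i => if fst i then a0 (snd i) else b0 (snd i))
    (trunc_nonlin lambda theta M) K M) as [v [Hv0 [Hvc Hvd]]].
  - intros [[|] n]; simpl fst; apply Rmult_lt_0_compat; auto;
      apply pow_lt, lam_pos; auto.
  - intros i; now apply lam_pos.
  - lra.
  - exact HM.
  - intros i; apply Rmult_le_pos; [lra|].
    apply pow_le; left; apply Hx.
  - intros i. specialize (Hcub (rt lambda ^ S (snd i)) (Rlt_le _ _ (Hx _))).
    assert (c <= if fst i then nu else mu)
      by (destruct (fst i); [apply Rmin_l|apply Rmin_r]).
    rewrite (lam_sqr_rt _ _ Hl).
    assert (H4 : 0 <= (rt lambda ^ S (snd i)) ^ 4) by (apply pow_le, Rlt_le; auto).
    assert (H5 := Rmult_le_compat_r _ _ _ H4 H). lra.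
  - intros u v d Hd Huv i.
    assert (Hdist : forall e, weighted_dist_le lambda d
      (trunc lambda M (fun n => u (e, n))) (trunc lambda M (fun n => v (e, n)))).
    { intros e; apply trunc_dist; intros [|n].
      - simpl; rewrite Rminus_diag, Rabs_R0; lra.
      - specialize (Huv (e, n)); cbn [fst snd] in Huv.
        assert (Hp := lam_pos lambda (S n) Hl). unfold coord.
        apply Rmult_le_reg_l with (lam lambda (S n)); [exact Hp|].
        eapply Rle_trans; [exact Huv|]. right; field; lra. }
    destruct (nonlin_lipschitz lambda theta M d Hl Ht HM Hd
      _ _ _ _ (S (snd i)) ltac:(lia)
      (weighted_bound_trunc lambda M (fun n => u (true, n)) Hl HM)
      (weighted_bound_trunc lambda M (fun n => u (false, n)) Hl HM)
      (weighted_bound_trunc lambda M (fun n => v (true, n)) Hl HM)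
      (weighted_bound_trunc lambda M (fun n => v (false, n)) Hl HM)
      (Hdist true) (Hdist false)) as [H1 H2].
    unfold trunc_nonlin; destruct (fst i); assumption.
  - intros u i.
    destruct (nonlin_trunc_bounded lambda theta M (fun n => u (true, n))
      (fun n => u (false, n)) (S (snd i)) Hl Ht HM ltac:(lia)) as [H1 H2].
    unfold trunc_nonlin; destruct (fst i); assumption.
  - intros f Hf i. unfold trunc_nonlin.
    assert (H : forall e, coords_continuous
      (fun t => trunc lambda M (fun n => f (e, n) t))).
    { intros e; apply (trunc_continuous lambda M (fun t n => f (e, n) t)).
      apply coords_continuous_of_entries; intros n; apply Hf. }
    destruct (fst i).
    + apply (nonlin_a_continuity _ _ _ _ _ (H true) (H false)).
    + apply (nonlin_b_continuity _ _ _ _ _ (H true) (H false)).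
  - exists (fun t n => v (true, n) t), (fun t n => v (false, n) t).
    split; [split; [|split]|split].
    + apply coords_continuous_of_entries; intros n; apply Hvc.
    + apply coords_continuous_of_entries; intros n; apply Hvc.
    + intros [|n] t Hj Ht0; [lia|].
      split; [exact (Hvd (true, n) t Ht0)|exact (Hvd (false, n) t Ht0)].
    + apply functional_extensionality; intros n; apply (Hv0 (true, n)).
    + apply functional_extensionality; intros n; apply (Hv0 (false, n)).
Qed.

(** On a step of length [/ K] the growth factor is at most [exp 1 <= 3], so the forcing adds at most
    [3 * (L * M) / (k + K) <= 1] to the weighted value: the unit margin between [M - 1] and [M]. *)
Lemma component_short_time_bound (k K L M w t0 t : R) (v g : R -> R) :
  0 < w -> 0 <= k -> 0 < K -> 0 <= L * M -> 3 * (L * M) <= k + K ->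
  t0 <= t <= t0 + / K ->
  (forall s, t0 <= s <= t -> is_derive v s (- k * v s + g s)) ->
  (forall s, t0 <= s <= t -> w * Rabs (g s) <= L * M) ->
  w * Rabs (v t0) <= M - 1 -> w * Rabs (v t) <= M.
Proof.
  intros Hw Hk HK HLM Hcub Ht Hv Hg Hv0.
  set (m := L * M / w).
  assert (Hm : 0 <= m) by (apply Rdiv_le_0_compat; lra).
  assert (HE : 1 <= exp (K * (t - t0)) <= 3).
  { split.
    - rewrite <- exp_0; apply exp_le_exp, Rmult_le_pos; lra.
    - eapply Rle_trans; [|apply exp_le_3]. apply exp_le_exp.
      replace 1 with (K * / K) by (field; lra).
      apply Rmult_le_compat_l; lra. }
  assert (H := linear_ode_bound k K m t0 t v g Hm ltac:(lra) ltac:(lra) Hv).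
  assert (HE' : exp (- k * (t - t0)) <= 1).
  { rewrite <- exp_0; apply exp_le_exp.
    assert (0 <= k * (t - t0)) by (apply Rmult_le_pos; lra). lra. }
  apply Rle_trans with (w * (1 * Rabs (v t0) + m * 3 / (k + K))).
  - apply Rmult_le_compat_l; [lra|]. eapply Rle_trans; [apply H|].
    + intros s Hs. apply Rle_trans with (m * 1).
      * rewrite Rmult_1_r. apply Rmult_le_reg_l with w; [lra|].
        eapply Rle_trans; [now apply Hg|]. right; unfold m; field; lra.
      * apply Rmult_le_compat_l; [exact Hm|].
        rewrite <- exp_0; apply exp_le_exp, Rmult_le_pos; lra.
    + assert (HP := Rabs_pos (v t0)). apply Rplus_le_compat; [nra|].
      apply Rmult_le_compat_r; [left; apply Rinv_0_lt_compat; lra|].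
      apply Rmult_le_compat_l; lra.
  - replace (w * (1 * Rabs (v t0) + m * 3 / (k + K)))
      with (w * Rabs (v t0) + 3 * (L * M) * / (k + K)) by (unfold m; field; lra).
    assert (3 * (L * M) * / (k + K) <= 1); [|lra].
    rewrite <- (Rinv_r (k + K)) by lra.
    apply Rmult_le_compat_r; [left; apply Rinv_0_lt_compat; lra|exact Hcub].
Qed.

(** The case [K = 0] of the linear estimate: damping alone gives a bound uniform in time, with the
    full gain [/ k]. *)
Lemma component_bound (k B w t : R) (v g : R -> R) :
  0 < w -> 0 < k -> 0 <= B -> 0 <= t ->
  (forall s, 0 <= s -> is_derive v s (- k * v s + g s)) ->
  (forall s, 0 <= s -> w * Rabs (g s) <= B) ->
  w * Rabs (v t) <= w * Rabs (v 0) + B / k.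
Proof.
  intros Hw Hk HB Ht Hv Hg.
  assert (Hm : 0 <= B / w) by (apply Rdiv_le_0_compat; lra).
  assert (H := linear_ode_bound k 0 (B / w) 0 t v g Hm ltac:(lra) Ht).
  rewrite Rplus_0_r, Rmult_0_l, exp_0, Rmult_1_r in H.
  assert (HE' : exp (- k * (t - 0)) <= 1).
  { rewrite <- exp_0; apply exp_le_exp.
    assert (0 <= k * t) by (apply Rmult_le_pos; lra). lra. }
  replace (w * Rabs (v 0) + B / k) with (w * (Rabs (v 0) + B / w / k))
    by (field; lra).
  apply Rmult_le_compat_l; [lra|]. eapply Rle_trans; [apply H|].
  - intros s Hs; apply Hv; lra.
  - intros s Hs. rewrite Rmult_0_l, exp_0, Rmult_1_r.
    apply Rmult_le_reg_l with w; [lra|].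
    eapply Rle_trans; [apply Hg; lra|]. right; field; lra.
  - assert (HP := Rabs_pos (v 0)). apply Rplus_le_compat_r. nra.
Qed.

Lemma weighted_bound_iff lambda M u : 1 < lambda -> 0 <= M ->
  weighted_bound lambda M u <->
  (forall j, (1 <= j)%nat -> lam lambda j * Rabs (coord u j) <= M).
Proof.
  intros Hl HM; split; intros H j.
  - intros _. assert (Hp := lam_pos lambda j Hl).
    specialize (H j). apply (Rmult_le_compat_l (lam lambda j)) in H; [|lra].
    eapply Rle_trans; [exact H|]. right; field; lra.
  - assert (Hp := lam_pos lambda j Hl).
    apply Rmult_le_reg_l with (lam lambda j); [exact Hp|].
    replace (lam lambda j * (M * / lam lambda j)) with M by (field; lra).
    destruct j as [|j]; [|apply H; lia].
    simpl coord; rewrite Rabs_R0; lra.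
Qed.

Section TruncatedSolution.

Context (lambda nu mu theta M : R) (a b : R -> sequence).
Context (lambda_gt1 : 1 < lambda).
Context (nu_pos : 0 < nu).
Context (mu_pos : 0 < mu).
Context (theta_le : theta <= 5 / 2).
Context (M_ge1 : 1 <= M).
Context (solves : truncated_solution lambda nu mu theta M a b).

Lemma weighted_bound_short_time :
  exists tau, 0 < tau /\ forall t0, 0 <= t0 ->
    weighted_bound lambda (M - 1) (a t0) -> weighted_bound lambda (M - 1) (b t0) ->
    forall t, t0 <= t <= t0 + tau ->
      weighted_bound lambda M (a t) /\ weighted_bound lambda M (b t).
Proof.
  destruct solves as [_ [_ Hd]].
  set (c := Rmin nu mu).
  assert (Hc : 0 < c) by now apply Rmin_pos.
  (* [8 * M * M] is the bound on the clipped forcing and [3] the growth factor over one step. The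
     resulting [K] does not involve [t0], so all steps have the same length. *)
  destruct (cubic_le_quartic (3 * (8 * M * M)) c) as [K [HK Hcub]]; [nra|exact Hc|].
  exists (/ K); split; [now apply Rinv_0_lt_compat|].
  intros t0 Ht0 Ha Hb t Ht.
  rewrite weighted_bound_iff in Ha by lra.
  rewrite weighted_bound_iff in Hb by lra.
  assert (Hr := rt_gt1 lambda lambda_gt1).
  assert (Hx : forall j, 0 < rt lambda ^ j) by (intros; apply pow_lt; lra).
  assert (Hkap : forall n j, c <= n ->
    3 * (8 * M * (rt lambda ^ j) ^ 3 * M) <= n * lam lambda j ^ 2 + K).
  { intros n j Hn. specialize (Hcub _ (Rlt_le _ _ (Hx j))).
    rewrite (lam_sqr_rt _ _ lambda_gt1).
    assert (H4 : 0 <= (rt lambda ^ j) ^ 4) by (apply pow_le, Rlt_le; auto).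
    assert (H5 := Rmult_le_compat_r _ _ _ H4 Hn). lra. }
  assert (HL : forall j, 0 <= 8 * M * (rt lambda ^ j) ^ 3 * M).
  { intros j; assert (0 < (rt lambda ^ j) ^ 3) by (apply pow_lt; auto).
    assert (0 <= M * M) by nra. nra. }
  assert (Hl2 : forall j, 0 < lam lambda j ^ 2)
    by (intros; apply pow_lt, lam_pos; lra).
  split; apply weighted_bound_iff; try lra; intros j Hj.
  - apply (component_short_time_bound (nu * lam lambda j ^ 2) K
      (8 * M * (rt lambda ^ j) ^ 3) M (lam lambda j) t0 t
      (fun s => coord (a s) j) (fun s => nonlin_a lambda theta
        (trunc lambda M (a s)) (trunc lambda M (b s)) j)); auto.
    + now apply lam_pos.
    + left; apply Rmult_lt_0_compat; auto.
    + apply Hkap, Rmin_l.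
    + intros s Hs; apply Hd; [exact Hj|lra].
    + intros s Hs; apply nonlin_trunc_bounded; auto; lra.
  - apply (component_short_time_bound (mu * lam lambda j ^ 2) K
      (8 * M * (rt lambda ^ j) ^ 3) M (lam lambda j) t0 t
      (fun s => coord (b s) j) (fun s => nonlin_b lambda theta
        (trunc lambda M (a s)) (trunc lambda M (b s)) j)); auto.
    + now apply lam_pos.
    + left; apply Rmult_lt_0_compat; auto.
    + apply Hkap, Rmin_r.
    + intros s Hs; apply Hd; [exact Hj|lra].
    + intros s Hs; apply nonlin_trunc_bounded; auto; lra.
Qed.

(* The nonlinear part gains the factor [lam j ^ (- 1/2)], hence stays in [H^1]
   although the truncation only controls the weighted supremum. *)
Lemma truncated_solution_decay :
  exists C, forall t j, 0 <= t -> (1 <= j)%nat ->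
    lam lambda j * Rabs (coord (a t) j)
      <= lam lambda j * Rabs (coord (a 0) j) + C * / rt lambda ^ j /\
    lam lambda j * Rabs (coord (b t) j)
      <= lam lambda j * Rabs (coord (b 0) j) + C * / rt lambda ^ j.
Proof.
  destruct solves as [_ [_ Hd]].
  assert (Hr := rt_gt1 lambda lambda_gt1).
  assert (Hx : forall j, 0 < rt lambda ^ j) by (intros; apply pow_lt; lra).
  assert (Hl2 : forall j, 0 < lam lambda j ^ 2)
    by (intros; apply pow_lt, lam_pos; lra).
  set (c := Rmin nu mu).
  assert (Hc : 0 < c) by now apply Rmin_pos.
  assert (HL : forall j, 0 <= 8 * M * (rt lambda ^ j) ^ 3 * M).
  { intros j; assert (0 < (rt lambda ^ j) ^ 3) by (apply pow_lt; auto).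
    assert (0 <= M * M) by nra. nra. }
  assert (Hq : forall n j, c <= n ->
    8 * M * (rt lambda ^ j) ^ 3 * M / (n * lam lambda j ^ 2)
    <= 8 * M * M / c * / rt lambda ^ j).
  { intros n j Hn.
    replace (8 * M * M / c * / rt lambda ^ j)
      with (8 * M * (rt lambda ^ j) ^ 3 * M / (c * lam lambda j ^ 2)).
    - apply Rmult_le_compat_l; [apply HL|].
      apply Rinv_le_contravar; [apply Rmult_lt_0_compat; auto|].
      apply Rmult_le_compat_r; [left|]; auto.
    - rewrite (lam_rt _ _ lambda_gt1); specialize (Hx j); field; lra. }
  exists (8 * M * M / c); intros t j Ht Hj.
  split.
  - eapply Rle_trans; [|apply Rplus_le_compat_l, Hq, Rmin_l].
    apply (component_bound (nu * lam lambda j ^ 2) _ _ t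
      (fun s => coord (a s) j) (fun s => nonlin_a lambda theta
        (trunc lambda M (a s)) (trunc lambda M (b s)) j)); auto.
    + now apply lam_pos.
    + now apply Rmult_lt_0_compat.
    + intros s Hs; now apply Hd.
    + intros s Hs; apply nonlin_trunc_bounded; auto; lra.
  - eapply Rle_trans; [|apply Rplus_le_compat_l, Hq, Rmin_r].
    apply (component_bound (mu * lam lambda j ^ 2) _ _ t
      (fun s => coord (b s) j) (fun s => nonlin_b lambda theta
        (trunc lambda M (a s)) (trunc lambda M (b s)) j)); auto.
    + now apply lam_pos.
    + now apply Rmult_lt_0_compat.
    + intros s Hs; now apply Hd.
    + intros s Hs; apply nonlin_trunc_bounded; auto; lra.
Qed.

End TruncatedSolution.

(** * From mode-by-mode bounds to the [H^1] norm *)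

Lemma norm_term_1 lambda u n : 1 < lambda ->
  norm_term lambda 1 u n = (lam lambda n * coord u n) ^ 2.
Proof.
  intros H; unfold norm_term. replace (2 * 1) with (INR 2) by (simpl; ring).
  rewrite Rpower_pow by now apply lam_pos. ring.
Qed.

Lemma norm_term_1_ge0 lambda u n : 1 < lambda -> 0 <= norm_term lambda 1 u n.
Proof. intros H; rewrite norm_term_1 by exact H; apply pow2_ge_0. Qed.

Lemma in_Hs_of_majorant lambda u (m : nat -> R) : 1 < lambda ->
  ex_series m -> (forall n, norm_term lambda 1 u (S n) <= m n) ->
  in_Hs lambda 1 u /\ norm_s lambda 1 u <= sqrt (Series m).
Proof.
  intros Hl Hm Hle; split.
  - apply (ex_series_le (K := R_AbsRing) (V := R_CompleteNormedModule) _ m);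
      [|exact Hm].
    intros n; unfold norm; simpl; unfold abs; simpl.
    rewrite Rabs_pos_eq by now apply norm_term_1_ge0. apply Hle.
  - apply sqrt_le_1_alt, Series_le; [|exact Hm].
    intros n; split; [now apply norm_term_1_ge0|apply Hle].
Qed.

Lemma in_Hs_1_in_H lambda u : 1 < lambda -> in_Hs lambda 1 u -> in_H u.
Proof.
  intros Hl Hu.
  apply (ex_series_le (K := R_AbsRing) (V := R_CompleteNormedModule) _
    (fun n => norm_term lambda 1 u (S n))); [|exact Hu].
  intros n; unfold norm; simpl norm; unfold abs; simpl abs.
  rewrite Rabs_pos_eq by apply pow2_ge_0.
  rewrite norm_term_1, Rpow_mult_distr by exact Hl.
  assert (H1 := pow_R1_Rle _ 2 (lam_ge1 lambda (S n) Hl)).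
  assert (H2 := pow2_ge_0 (coord u (S n))). nra.
Qed.

(** By [(y + z)^2 <= 2 y^2 + 2 z^2] the [H^1] density at time [t] is dominated by twice that of the
    data plus [2 * C ^ 2 / lam j], a geometric series. This majorant does not depend on [t]. *)
Lemma bounded_in_H1_of_decay lambda C (u : R -> sequence) :
  1 < lambda -> in_Hs lambda 1 (u 0) ->
  (forall t j, 0 <= t -> (1 <= j)%nat ->
    lam lambda j * Rabs (coord (u t) j)
      <= lam lambda j * Rabs (coord (u 0) j) + C * / rt lambda ^ j) ->
  exists N, forall t, 0 <= t -> in_Hs lambda 1 (u t) /\ norm_s lambda 1 (u t) <= N.
Proof.
  intros Hl Hu Hdec.
  set (m := fun n => 2 * norm_term lambda 1 (u 0) (S n)
    + 2 * C ^ 2 * / lambda * (/ lambda) ^ n).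
  exists (sqrt (Series m)); intros t Ht.
  apply in_Hs_of_majorant; [exact Hl| |].
  - apply (ex_series_plus (K := R_AbsRing) (V := R_NormedModule)
      (fun n => 2 * norm_term lambda 1 (u 0) (S n))
      (fun n => 2 * C ^ 2 * / lambda * (/ lambda) ^ n)).
    + now apply (ex_series_scal (K := R_AbsRing) (V := R_NormedModule) 2).
    + apply (ex_series_scal (K := R_AbsRing) (V := R_NormedModule)
        (2 * C ^ 2 * / lambda) (fun n => (/ lambda) ^ n)).
      apply ex_series_geom. rewrite Rabs_pos_eq.
      * rewrite <- Rinv_1; apply Rinv_lt_contravar; lra.
      * left; apply Rinv_0_lt_compat; lra.
  - intros n; unfold m. specialize (Hdec t (S n) Ht ltac:(lia)).
    rewrite !norm_term_1 by exact Hl.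
    assert (Hp := lam_pos lambda (S n) Hl).
    set (x := lam lambda (S n) * coord (u t) (S n)).
    set (y := lam lambda (S n) * coord (u 0) (S n)).
    assert (Hx : lam lambda (S n) * Rabs (coord (u t) (S n)) = Rabs x)
      by (unfold x; rewrite Rabs_mult, (Rabs_pos_eq (lam _ _)); lra).
    assert (Hy : lam lambda (S n) * Rabs (coord (u 0) (S n)) = Rabs y)
      by (unfold y; rewrite Rabs_mult, (Rabs_pos_eq (lam _ _)); lra).
    rewrite Hx, Hy in Hdec.
    replace (2 * C ^ 2 * / lambda * (/ lambda) ^ n)
      with (2 * (C * / rt lambda ^ S n) ^ 2).
    + rewrite <- (pow2_abs x), <- (pow2_abs y).
      assert (H0 := Rabs_pos x).
      assert (Rabs x ^ 2 <= (Rabs y + C * / rt lambda ^ S n) ^ 2)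
        by (apply pow_incr; lra).
      assert (Hsq := pow2_ge_0 (Rabs y - C * / rt lambda ^ S n)). nra.
    + assert (Hr := rt_gt1 lambda Hl).
      assert (Hi : (/ rt lambda ^ S n) ^ 2 = / (lambda * lambda ^ n))
        by (rewrite pow_inv, <- (lam_rt lambda (S n) Hl); reflexivity).
      replace ((C * / rt lambda ^ S n) ^ 2) with (C ^ 2 * (/ rt lambda ^ S n) ^ 2)
        by ring.
      rewrite Hi, (pow_inv lambda). field.
      split; [apply pow_nonzero|]; lra.
Qed.

(** * Energy and enstrophy estimates *)

Lemma sum_n_S (f : nat -> R) N : sum_n f (S N) = sum_n f N + f (S N).
Proof. exact (sum_Sn f N). Qed.

Lemma sum_n_0 (f : nat -> R) : sum_n f 0 = f 0%nat.
Proof. exact (sum_O f). Qed.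

Lemma sum_n_le_R (f g : nat -> R) N :
  (forall j, (j <= N)%nat -> f j <= g j) -> sum_n f N <= sum_n g N.
Proof. intros H; rewrite !sum_n_Reals; now apply sum_Rle. Qed.

Lemma sum_n_le_index (f : nat -> R) N m :
  (forall j, 0 <= f j) -> (N <= m)%nat -> sum_n f N <= sum_n f m.
Proof.
  intros Hf H; induction H as [|m H IH]; [lra|].
  rewrite sum_n_S. specialize (Hf (S m)); lra.
Qed.

Lemma term_le_sum_n (f : nat -> R) N j :
  (forall i, 0 <= f i) -> (j <= N)%nat -> f j <= sum_n f N.
Proof.
  intros Hf Hj; apply Rle_trans with (sum_n f j); [|now apply sum_n_le_index].
  destruct j as [|j]; [rewrite sum_n_0; lra|]. rewrite sum_n_S.
  assert (H := sum_n_le_index f 0 j Hf (Nat.le_0_l j)).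
  rewrite sum_n_0 in H; specialize (Hf 0%nat); lra.
Qed.

(** The free weight covers both uses: [1] for the [l^2] energy and [lam lambda j ^ 2] for the
    enstrophy. The index [0] contributes nothing, by the convention in [coord], and makes the base
    case of inductions trivial. *)
Definition energy (w : nat -> R) (a b : sequence) (N : nat) : R :=
  sum_n (fun j => w j * (coord a j ^ 2 + coord b j ^ 2)) N.

(** The formal time derivative of [energy] along the unclipped system, as a function of the state,
    so that the estimates on it are purely algebraic. *)
Definition energy_rate (w : nat -> R) (lambda nu mu theta : R)
    (a b : sequence) (N : nat) : R :=
  sum_n (fun j => w j * (2 * coord a j * rhs_a lambda nu theta a b j
                         + 2 * coord b j * rhs_b lambda mu theta a b j)) N.

Lemma energy_term_ge0 (w : nat -> R) a b j :
  0 <= w j -> 0 <= w j * (coord a j ^ 2 + coord b j ^ 2).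
Proof.
  intros H; apply Rmult_le_pos; [exact H|].
  assert (H1 := pow2_ge_0 (coord a j)); assert (H2 := pow2_ge_0 (coord b j)); lra.
Qed.

Definition enstrophy (lambda : R) : sequence -> sequence -> nat -> R :=
  energy (fun j => lam lambda j ^ 2).

Lemma enstrophy_term_ge0 lambda a b j :
  0 <= lam lambda j ^ 2 * (coord a j ^ 2 + coord b j ^ 2).
Proof. apply (energy_term_ge0 (fun j => lam lambda j ^ 2)), pow2_ge_0. Qed.

Lemma enstrophy_ge0 lambda a b N : 0 <= enstrophy lambda a b N.
Proof.
  assert (Ht := enstrophy_term_ge0 lambda a b).
  exact (Rle_trans _ _ _ (Ht N) (term_le_sum_n _ N N Ht (le_n N))).
Qed.

Lemma energy_le_enstrophy lambda a b N : 1 < lambda ->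
  energy (fun _ => 1) a b N <= enstrophy lambda a b N.
Proof.
  intros Hl; apply sum_n_le_R; intros j _.
  assert (H := pow_R1_Rle _ 2 (lam_ge1 lambda j Hl)).
  assert (H' := energy_term_ge0 (fun _ => 1) a b j Rle_0_1). nra.
Qed.

(* The nonlinear terms telescope to the flux through the last mode. *)
Lemma energy_rate_le lambda nu mu theta c a b N :
  c <= nu -> c <= mu ->
  energy_rate (fun _ => 1) lambda nu mu theta a b N
  <= - (2 * c) * enstrophy lambda a b N
     + 2 * wgt lambda theta N * (coord b N ^ 2 - coord a N ^ 2) * coord a (S N).
Proof.
  intros Hnu Hmu; unfold energy_rate, enstrophy, energy.
  induction N as [|N IH]; [rewrite !sum_n_0; simpl; lra|].
  rewrite !sum_n_S. rewrite rhs_a_nonlin, rhs_b_nonlin.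
  unfold nonlin_a, nonlin_b. replace (S N - 1)%nat with N by lia.
  assert (Ha : c * (lam lambda (S N) * coord a (S N)) ^ 2
    <= nu * (lam lambda (S N) * coord a (S N)) ^ 2)
    by (apply Rmult_le_compat_r; [apply pow2_ge_0|exact Hnu]).
  assert (Hb : c * (lam lambda (S N) * coord b (S N)) ^ 2
    <= mu * (lam lambda (S N) * coord b (S N)) ^ 2)
    by (apply Rmult_le_compat_r; [apply pow2_ge_0|exact Hmu]).
  lra.
Qed.

(** This is where [theta <= 2], that is [delta >= 1], enters: the coupling weight is then at most
    [lam N ^ 2], and the flux is an enstrophy density times one coordinate. *)
Lemma enstrophy_flux_bound lambda theta a b N : 1 < lambda -> theta <= 2 ->
  Rabs (wgt lambda theta N * (coord b N ^ 2 - coord a N ^ 2) * coord a (S N))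
  <= lam lambda N ^ 2 * (coord a N ^ 2 + coord b N ^ 2) * Rabs (coord a (S N)).
Proof.
  intros Hl Ht. rewrite !Rabs_mult, (Rabs_pos_eq (wgt _ _ _)) by
    apply Rlt_le, wgt_pos.
  apply Rmult_le_compat_r; [apply Rabs_pos|].
  apply Rmult_le_compat; [apply Rlt_le, wgt_pos|apply Rabs_pos| |].
  - now apply wgt_le_lam.
  - assert (H1 := pow2_ge_0 (coord a N)); assert (H2 := pow2_ge_0 (coord b N)).
    apply Rabs_le; lra.
Qed.

(** Young's inequality splits the cubic term into the dissipation and [lam j ^ 4 * v * z ^ 2]. The
    four powers are then shared out evenly, giving the product of two neighbouring enstrophy
    densities. *)
Lemma dissipation_absorbs lambda c a b j : 1 < lambda -> 0 < c ->
  4 * lambda ^ 2 * (lam lambda j ^ 4 * (coord a j ^ 2 + coord b j ^ 2)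
                    * Rabs (coord a (S j)))
  <= 2 * c * (lam lambda j ^ 4 * (coord a j ^ 2 + coord b j ^ 2))
     + 2 * lambda ^ 4 / c
       * (lam lambda j ^ 2 * (coord a j ^ 2 + coord b j ^ 2)
          * (lam lambda (S j) ^ 2 * (coord a (S j) ^ 2 + coord b (S j) ^ 2))).
Proof.
  intros Hl Hc.
  set (v := coord a j ^ 2 + coord b j ^ 2).
  set (z := Rabs (coord a (S j))). set (L := lam lambda j).
  assert (Hv : 0 <= v).
  { assert (H1 := pow2_ge_0 (coord a j)); assert (H2 := pow2_ge_0 (coord b j)).
    unfold v; lra. }
  assert (HL : 1 <= L) by now apply lam_ge1.
  assert (Hz : 4 * lambda ^ 2 * z <= 2 * c + 2 * lambda ^ 4 / c * z ^ 2).
  { apply Rmult_le_reg_l with c; [exact Hc|].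
    replace (c * (2 * c + 2 * lambda ^ 4 / c * z ^ 2))
      with (2 * c ^ 2 + 2 * (lambda ^ 2 * z) ^ 2) by (field; lra).
    assert (H := pow2_ge_0 (c - lambda ^ 2 * z)). lra. }
  assert (Hz2 : L ^ 2 * z ^ 2
    <= lam lambda (S j) ^ 2 * (coord a (S j) ^ 2 + coord b (S j) ^ 2)).
  { unfold z; rewrite pow2_abs. apply Rmult_le_compat;
      [apply pow2_ge_0|apply pow2_ge_0| |].
    - apply pow_incr. rewrite (lam_S lambda j); fold L; nra.
    - assert (H := pow2_ge_0 (coord b (S j))); lra. }
  assert (Hq : 0 <= 2 * lambda ^ 4 / c).
  { apply Rdiv_le_0_compat; [|lra].
    assert (H := pow_lt lambda 4 ltac:(lra)); lra. }
  assert (HLv : 0 <= L ^ 4 * v) by (apply Rmult_le_pos; [apply pow_le; lra|lra]).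
  assert (HLv2 : 0 <= L ^ 2 * v) by (apply Rmult_le_pos; [apply pow_le; lra|lra]).
  apply Rle_trans with (L ^ 4 * v * (2 * c + 2 * lambda ^ 4 / c * z ^ 2)).
  - apply (Rmult_le_compat_l _ _ _ HLv) in Hz. lra.
  - apply (Rmult_le_compat_l _ _ _ HLv2) in Hz2.
    apply (Rmult_le_compat_l _ _ _ Hq) in Hz2. lra.
Qed.

Lemma enstrophy_rate_le_sum lambda nu mu theta c a b N :
  1 < lambda -> theta <= 2 -> 0 < c -> c <= nu -> c <= mu ->
  energy_rate (fun j => lam lambda j ^ 2) lambda nu mu theta a b N
  <= 2 * lambda ^ 4 / c * sum_n (fun j =>
       lam lambda j ^ 2 * (coord a j ^ 2 + coord b j ^ 2)
       * (lam lambda (S j) ^ 2 * (coord a (S j) ^ 2 + coord b (S j) ^ 2))) N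
     + 2 * lambda ^ 2 * lam lambda N ^ 2
       * (wgt lambda theta N * (coord b N ^ 2 - coord a N ^ 2) * coord a (S N))
     - 2 * lambda ^ 2 * (lam lambda N ^ 4 * (coord a N ^ 2 + coord b N ^ 2)
                         * Rabs (coord a (S N))).
Proof.
  intros Hl Ht Hc Hnu Hmu; unfold energy_rate.
  induction N as [|N IH]; [rewrite !sum_n_0; simpl; lra|].
  rewrite !sum_n_S. rewrite rhs_a_nonlin, rhs_b_nonlin.
  unfold nonlin_a, nonlin_b. replace (S N - 1)%nat with N by lia.
  assert (Hflux := enstrophy_flux_bound lambda theta a b N Hl Ht).
  assert (Hflux' := enstrophy_flux_bound lambda theta a b (S N) Hl Ht).
  assert (Habs := dissipation_absorbs lambda c a b (S N) Hl Hc).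
  assert (Hl2 : 1 < lambda ^ 2) by nra.
  set (A := 2 * lambda ^ 4 / c) in *.
  assert (Ha : c * (lam lambda (S N) ^ 2 * coord a (S N)) ^ 2
    <= nu * (lam lambda (S N) ^ 2 * coord a (S N)) ^ 2)
    by (apply Rmult_le_compat_r; [apply pow2_ge_0|exact Hnu]).
  assert (Hb : c * (lam lambda (S N) ^ 2 * coord b (S N)) ^ 2
    <= mu * (lam lambda (S N) ^ 2 * coord b (S N)) ^ 2)
    by (apply Rmult_le_compat_r; [apply pow2_ge_0|exact Hmu]).
  set (x := wgt lambda theta N * (coord b N ^ 2 - coord a N ^ 2) * coord a (S N)) in *.
  set (x' := wgt lambda theta (S N) * (coord b (S N) ^ 2 - coord a (S N) ^ 2)
    * coord a (S (S N))) in *.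
  apply Rabs_le_between in Hflux, Hflux'.
  set (L' := lam lambda (S N)) in *. set (L := lam lambda N) in *.
  assert (HL : L' ^ 2 = lambda ^ 2 * L ^ 2)
    by (unfold L'; rewrite (lam_S lambda N); fold L; ring).
  set (p := L ^ 2 * (coord a N ^ 2 + coord b N ^ 2) * Rabs (coord a (S N))) in *.
  set (p' := L' ^ 2 * (coord a (S N) ^ 2 + coord b (S N) ^ 2)
    * Rabs (coord a (S (S N)))) in *.
  assert (HL2 : 0 <= L ^ 2) by apply pow2_ge_0.
  assert (HL2' : 0 <= L' ^ 2) by apply pow2_ge_0.
  assert (Hq : L' ^ 2 * x = lambda ^ 2 * L ^ 2 * x) by (rewrite HL; ring).
  assert (H1 : 0 <= lambda ^ 2 * (L ^ 2 * p)).
  { apply Rmult_le_pos; [lra|]. apply Rmult_le_pos; lra. }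
  (* The new mode has flux [2 x'] where the claim has [2 lambda^2 x']. This difference and the new
     subtracted term cost [(4 lambda^2 - 2) * L'^2 * p'] in all, within the [4 lambda^2] absorbed by
     dissipation. *)
  assert (H2 : (lambda ^ 2 - 1) * (L' ^ 2 * - x') <= (lambda ^ 2 - 1) * (L' ^ 2 * p'))
    by (apply Rmult_le_compat_l; [lra|]; apply Rmult_le_compat_l; lra).
  assert (H3 : 0 <= L' ^ 2 * p') by (apply Rmult_le_pos; lra).
  replace (L ^ 4 * (coord a N ^ 2 + coord b N ^ 2) * Rabs (coord a (S N)))
    with (L ^ 2 * p) in IH by (unfold p; ring).
  replace (L' ^ 4 * (coord a (S N) ^ 2 + coord b (S N) ^ 2)
    * Rabs (coord a (S (S N)))) with (L' ^ 2 * p') in * by (unfold p'; ring).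
  match goal with |- _ + ?t <= _ => assert (Hterm : t =
    - 2 * nu * (L' ^ 2 * coord a (S N)) ^ 2 - 2 * mu * (L' ^ 2 * coord b (S N)) ^ 2
    - 2 * (L' ^ 2 * x) + 2 * (L' ^ 2 * x')) by (unfold x, x'; ring) end.
  rewrite Hterm, Hq. clearbody x x' p p' A. clear Hflux Hflux' Hterm Hq HL.
  lra.
Qed.

(** After the boundary terms are dropped, each neighbouring density is bounded by the whole sum; the
    pair [(N, S N)] forces the level [S N] in one factor. *)
Lemma enstrophy_rate_le lambda nu mu theta c a b N :
  1 < lambda -> theta <= 2 -> 0 < c -> c <= nu -> c <= mu ->
  energy_rate (fun j => lam lambda j ^ 2) lambda nu mu theta a b N
  <= 2 * lambda ^ 4 / c * enstrophy lambda a b (S N) * enstrophy lambda a b N.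
Proof.
  intros Hl Ht Hc Hnu Hmu.
  assert (HT := enstrophy_rate_le_sum lambda nu mu theta c a b N Hl Ht Hc Hnu Hmu).
  assert (HF := enstrophy_flux_bound lambda theta a b N Hl Ht).
  assert (Hl2 : 0 <= 2 * lambda ^ 2 * lam lambda N ^ 2).
  { apply Rmult_le_pos; [|apply pow2_ge_0]. assert (H := pow2_ge_0 lambda); lra. }
  apply Rabs_le_between in HF; destruct HF as [_ HF].
  apply (Rmult_le_compat_l _ _ _ Hl2) in HF.
  assert (HA : 0 <= 2 * lambda ^ 4 / c).
  { apply Rdiv_le_0_compat; [|lra].
    assert (H := pow_lt lambda 4 ltac:(lra)); lra. }
  apply Rle_trans with (2 * lambda ^ 4 / c * sum_n (fun j =>
       lam lambda j ^ 2 * (coord a j ^ 2 + coord b j ^ 2)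
       * (lam lambda (S j) ^ 2 * (coord a (S j) ^ 2 + coord b (S j) ^ 2))) N).
  - lra.
  - rewrite Rmult_assoc. apply Rmult_le_compat_l; [exact HA|].
    unfold enstrophy at 2, energy. rewrite Rmult_comm, !sum_n_Reals, Rmult_comm.
    rewrite scal_sum. apply sum_Rle; intros j Hj.
    apply Rmult_le_compat_l; [apply enstrophy_term_ge0|].
    apply (term_le_sum_n _ (S N) (S j) (enstrophy_term_ge0 lambda a b)); lia.
Qed.

Lemma energy_continuity w (a b : R -> sequence) N :
  coords_continuous a -> coords_continuous b ->
  continuity (fun t => energy w (a t) (b t) N).
Proof.
  intros Ha Hb.
  assert (Hterm : forall j, continuity
    (fun t => w j * (coord (a t) j ^ 2 + coord (b t) j ^ 2))).
  { intros j t.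
    apply (continuity_pt_scal (fun t => coord (a t) j ^ 2 + coord (b t) j ^ 2)).
    apply (continuity_pt_plus (fun t => coord (a t) j ^ 2)).
    - apply (continuity_pt_comp (fun t => coord (a t) j) (fun x => x ^ 2));
        [apply Ha|apply derivable_continuous_pt, derivable_pt_pow].
    - apply (continuity_pt_comp (fun t => coord (b t) j) (fun x => x ^ 2));
        [apply Hb|apply derivable_continuous_pt, derivable_pt_pow]. }
  unfold energy; induction N as [|N IH]; intros t.
  - eapply continuity_pt_ext; [|apply (Hterm 0%nat t)].
    intros s; now rewrite sum_n_0.
  - eapply continuity_pt_ext;
      [|apply (continuity_pt_plus _ _ t (IH t) (Hterm (S N) t))].
    intros s; unfold plus_fct; now rewrite sum_n_S.
Qed.

(** * A priori bounds on an interval where the unclipped system holds *)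

Section APriori.

Context (lambda nu mu theta c M T E : R) (a b : R -> sequence).
Context (lambda_gt1 : 1 < lambda).
Context (theta_le2 : theta <= 2).
Context (c_pos : 0 < c).
Context (c_le_nu : c <= nu).
Context (c_le_mu : c <= mu).
Context (M_ge0 : 0 <= M).
Context (a_continuous : coords_continuous a).
Context (b_continuous : coords_continuous b).
Context (solves : forall j t, (1 <= j)%nat -> 0 <= t <= T ->
  is_derive (fun s => coord (a s) j) t (rhs_a lambda nu theta (a t) (b t) j) /\
  is_derive (fun s => coord (b s) j) t (rhs_b lambda mu theta (a t) (b t) j)).
Context (bounded : forall t, 0 <= t <= T ->
  weighted_bound lambda M (a t) /\ weighted_bound lambda M (b t)).
Context (initial : forall N, enstrophy lambda (a 0) (b 0) N <= E).

Lemma energy_is_derive w N t : 0 <= t <= T ->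
  is_derive (fun s => energy w (a s) (b s) N) t
    (energy_rate w lambda nu mu theta (a t) (b t) N).
Proof.
  intros Ht. unfold energy, energy_rate.
  apply (is_derive_sum_n (K := R_AbsRing) (V := R_NormedModule)
    (fun j s => w j * (coord (a s) j ^ 2 + coord (b s) j ^ 2))).
  intros [|j] _.
  - simpl coord. evar_last;
      [apply (is_derive_const (K := R_AbsRing) (V := R_NormedModule))|].
    change (@zero R_NormedModule) with 0; ring.
  - destruct (solves (S j) t ltac:(lia) Ht) as [Ha Hb].
    assert (Ha2 := is_derive_pow _ 2 _ _ Ha).
    assert (Hb2 := is_derive_pow _ 2 _ _ Hb).
    assert (Hp := is_derive_plus _ _ _ _ _ Ha2 Hb2).
    evar_last; [apply (is_derive_scal _ _ (w (S j)) _ Hp)|].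
    unfold plus; simpl; ring.
Qed.

(** The two densities are at most [M ^ 2] each and the outer coordinate at most [M / lam (S N)], so
    the energy flux through mode [N] vanishes geometrically as [N] grows. *)
Lemma boundary_flux_bound N t : 0 <= t <= T ->
  2 * wgt lambda theta N * (coord (b t) N ^ 2 - coord (a t) N ^ 2)
    * coord (a t) (S N) <= 4 * M ^ 3 / lambda ^ N.
Proof.
  intros Ht. destruct (bounded t Ht) as [Ha Hb].
  assert (HF := enstrophy_flux_bound lambda theta (a t) (b t) N
    lambda_gt1 theta_le2).
  apply Rabs_le_between in HF; destruct HF as [_ HF].
  assert (Hp := lam_pos lambda N lambda_gt1).
  assert (Hp' := lam_pos lambda (S N) lambda_gt1).
  assert (Hsq : forall u, weighted_bound lambda M u ->
    lam lambda N ^ 2 * coord u N ^ 2 <= M ^ 2).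
  { intros u Hu. rewrite <- Rpow_mult_distr, <- pow2_abs. apply pow_incr.
    split; [apply Rabs_pos|]. rewrite Rabs_mult, Rabs_pos_eq by lra.
    specialize (Hu N). apply (Rmult_le_compat_l (lam lambda N)) in Hu; [|lra].
    eapply Rle_trans; [exact Hu|]; right; field; lra. }
  assert (H1 := Hsq _ Ha). assert (H2 := Hsq _ Hb). specialize (Ha (S N)).
  assert (H3 : M * / lam lambda (S N) <= M * / lambda ^ N).
  { apply Rmult_le_compat_l; [lra|]. apply Rinv_le_contravar; [exact Hp|].
    rewrite (lam_S lambda N). unfold lam in *; nra. }
  assert (H4 : lam lambda N ^ 2 * (coord (a t) N ^ 2 + coord (b t) N ^ 2)
    * Rabs (coord (a t) (S N)) <= (2 * M ^ 2) * (M * / lambda ^ N)).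
  { apply Rmult_le_compat; [|apply Rabs_pos|lra|lra].
    apply enstrophy_term_ge0. }
  replace (4 * M ^ 3 / lambda ^ N) with (2 * (2 * M ^ 2 * (M * / lambda ^ N)))
    by (field; apply pow_nonzero; lra).
  lra.
Qed.

Definition enstrophy_integral (N : nat) (t : R) : R :=
  RInt (fun s => enstrophy lambda (a s) (b s) N) 0 t.

Lemma enstrophy_integral_0 N : enstrophy_integral N 0 = 0.
Proof. exact (RInt_point 0 (fun s => enstrophy lambda (a s) (b s) N)). Qed.

Lemma enstrophy_integral_is_derive N t :
  is_derive (enstrophy_integral N) t (enstrophy lambda (a t) (b t) N).
Proof.
  apply (is_derive_RInt_continuous (fun s => enstrophy lambda (a s) (b s) N)).
  now apply energy_continuity.
Qed.

(** The energy balance is taken at a level [m >= N] so high that the flux costs at most 1 over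
    [[0, T]]. Only [m] depends on [M] and [T]; the bound [E + 1] does not. The same [E] bounds the
    initial energy, which is at most the initial enstrophy. *)
Lemma enstrophy_integral_le N t : 0 <= t <= T ->
  2 * c * enstrophy_integral N t <= E + 1.
Proof.
  intros Ht.
  destruct (div_pow_small lambda (4 * M ^ 3 * T) 1 lambda_gt1 Rlt_0_1) as [m0 Hm0].
  set (m := Nat.max N m0).
  assert (HmN : (N <= m)%nat) by apply Nat.le_max_l.
  assert (Hm : 4 * M ^ 3 / lambda ^ m * T <= 1).
  { apply Rle_trans with (4 * M ^ 3 * T / lambda ^ m0); [|lra].
    replace (4 * M ^ 3 / lambda ^ m * T) with (4 * M ^ 3 * T / lambda ^ m)
      by (field; apply pow_nonzero; lra).
    apply Rmult_le_compat_l.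
    - apply Rmult_le_pos; [|lra]. assert (H := pow_le M 3 M_ge0); lra.
    - apply Rinv_le_contravar; [apply pow_lt; lra|].
      apply Rle_pow; [lra|apply Nat.le_max_r]. }
  set (q := 4 * M ^ 3 / lambda ^ m) in *.
  assert (H := derive_le_increment_le
    (fun s => energy (fun _ => 1) (a s) (b s) m)
    (fun s => - (2 * c) * enstrophy_integral N s + q * s)
    (fun s => energy_rate (fun _ => 1) lambda nu mu theta (a s) (b s) m)
    (fun s => - (2 * c) * enstrophy lambda (a s) (b s) N + q)
    0 t (proj1 Ht)).
  cbv beta in H. rewrite enstrophy_integral_0 in H.
  assert (H0 := energy_le_enstrophy lambda (a 0) (b 0) m lambda_gt1).
  assert (H1 := initial m).
  assert (Hq : 0 <= q).
  { apply Rdiv_le_0_compat; [|apply pow_lt; lra].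
    assert (H2 := pow_le M 3 M_ge0); lra. }
  assert (H2 : q * t <= q * T) by (apply Rmult_le_compat_l; lra).
  assert (H3 : 0 <= energy (fun _ => 1) (a t) (b t) m).
  { assert (H3 := fun j => energy_term_ge0 (fun _ => 1) (a t) (b t) j Rle_0_1).
    exact (Rle_trans _ _ _ (H3 m) (term_le_sum_n _ m m H3 (le_n m))). }
  enough (energy (fun _ => 1) (a t) (b t) m - energy (fun _ => 1) (a 0) (b 0) m
    <= - (2 * c) * enstrophy_integral N t + q * t
       - (- (2 * c) * 0 + q * 0)) by lra.
  apply H; intros s Hs.
  - apply energy_is_derive; lra.
  - evar_last;
      [apply (is_derive_plus (K := R_AbsRing) (V := R_NormedModule));
        [apply is_derive_scal, enstrophy_integral_is_derive
        |apply (is_derive_scal (fun x => x)),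
           (is_derive_id (K := R_AbsRing))]|].
    unfold plus, one; simpl; ring.
  - eapply Rle_trans; [now apply energy_rate_le with (c := c)|].
    apply Rplus_le_compat; [|apply boundary_flux_bound; lra].
    assert (H4 := sum_n_le_index _ N m (enstrophy_term_ge0 lambda (a s) (b s)) HmN).
    fold (enstrophy lambda (a s) (b s) N) in H4.
    change (enstrophy lambda (a s) (b s) N <= enstrophy lambda (a s) (b s) m) in H4.
    assert (0 <= 2 * c) by lra. nra.
Qed.

(** Gronwall with [S_(N+1)] treated as a given coefficient: the inequality is linear in [S_N], and
    the exponent is controlled by [enstrophy_integral_le] at level [S N]. *)
Lemma enstrophy_le N t : 0 <= t <= T ->
  enstrophy lambda (a t) (b t) N
  <= E * exp (2 * lambda ^ 4 / c * ((E + 1) / (2 * c))).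
Proof.
  intros Ht. set (A := 2 * lambda ^ 4 / c).
  assert (HA : 0 <= A).
  { apply Rdiv_le_0_compat; [|lra].
    assert (H := pow_lt lambda 4 ltac:(lra)); lra. }
  assert (H := derive_le_increment_le
    (fun s => enstrophy lambda (a s) (b s) N * exp (- A * enstrophy_integral (S N) s))
    (fun _ => 0)
    (fun s => energy_rate (fun j => lam lambda j ^ 2) lambda nu mu theta (a s) (b s) N
                * exp (- A * enstrophy_integral (S N) s)
              + enstrophy lambda (a s) (b s) N
                * (- A * enstrophy lambda (a s) (b s) (S N)
                   * exp (- A * enstrophy_integral (S N) s)))
    (fun _ => 0) 0 t (proj1 Ht)).
  cbv beta in H. rewrite enstrophy_integral_0, Rmult_0_r, exp_0 in H.
  assert (HG : enstrophy lambda (a t) (b t) N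
    * exp (- A * enstrophy_integral (S N) t)
    - enstrophy lambda (a 0) (b 0) N * 1 <= 0 - 0).
  { apply H; intros s Hs.
    - assert (Hd := energy_is_derive (fun j => lam lambda j ^ 2) N s ltac:(lra)).
      assert (He := is_derive_comp exp (fun x => - A * enstrophy_integral (S N) x)
        s _ _ (is_derive_exp _)
        (is_derive_scal _ _ (- A) _ (enstrophy_integral_is_derive (S N) s))).
      assert (Hp := is_derive_mult _ _ _ _ _ Hd He Rmult_comm).
      evar_last; [exact Hp|reflexivity].
    - apply (is_derive_const (K := R_AbsRing) (V := R_NormedModule)).
    - assert (HR := enstrophy_rate_le lambda nu mu theta c (a s) (b s) N
        lambda_gt1 theta_le2 c_pos c_le_nu c_le_mu). fold A in HR.
      assert (HX := exp_pos (- A * enstrophy_integral (S N) s)). nra. }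
  assert (HI := enstrophy_integral_le (S N) t Ht).
  assert (H0 := initial N).
  assert (Hinv : exp (A * enstrophy_integral (S N) t)
    * exp (- A * enstrophy_integral (S N) t) = 1).
  { rewrite <- exp_plus. rewrite <- exp_0. f_equal; ring. }
  assert (HX := exp_pos (A * enstrophy_integral (S N) t)).
  assert (Hmono : exp (A * enstrophy_integral (S N) t)
    <= exp (A * ((E + 1) / (2 * c)))).
  { apply exp_le_exp, Rmult_le_compat_l; [exact HA|].
    apply Rmult_le_reg_l with (2 * c); [lra|].
    replace (2 * c * ((E + 1) / (2 * c))) with (E + 1) by (field; lra). exact HI. }
  assert (HS := enstrophy_ge0 lambda (a 0) (b 0) N).
  apply Rle_trans with (E * exp (A * enstrophy_integral (S N) t)).
  - replace (enstrophy lambda (a t) (b t) N) with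
      (exp (A * enstrophy_integral (S N) t) * (enstrophy lambda (a t) (b t) N
        * exp (- A * enstrophy_integral (S N) t)))
      by (rewrite (Rmult_comm (enstrophy _ _ _ _)), <- Rmult_assoc, Hinv; ring).
    rewrite (Rmult_comm E). apply Rmult_le_compat_l; lra.
  - apply Rmult_le_compat_l; lra.
Qed.

End APriori.

(** Each weighted coordinate has square at most [Q]; since [x ^ 2 <= Q] implies [x <= Q + 1], this
    avoids a square root. *)
Lemma weighted_bound_of_enstrophy lambda Q a b : 1 < lambda ->
  (forall N, enstrophy lambda a b N <= Q) ->
  weighted_bound lambda (Q + 1) a /\ weighted_bound lambda (Q + 1) b.
Proof.
  intros Hl HQ.
  assert (HQ0 := Rle_trans _ _ _ (enstrophy_ge0 lambda a b 0) (HQ 0%nat)).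
  assert (Hterm : forall j, (lam lambda j * Rabs (coord a j)) ^ 2
    + (lam lambda j * Rabs (coord b j)) ^ 2 <= Q).
  { intros j. rewrite !Rpow_mult_distr, !pow2_abs, <- Rmult_plus_distr_l.
    eapply Rle_trans; [|apply (HQ j)].
    exact (term_le_sum_n _ j j (enstrophy_term_ge0 lambda a b) (le_n j)). }
  split; apply weighted_bound_iff; try lra; intros j _; specialize (Hterm j);
    assert (H1 := pow2_ge_0 (lam lambda j * Rabs (coord a j)));
    assert (H2 := pow2_ge_0 (lam lambda j * Rabs (coord b j))); nra.
Qed.

Lemma enstrophy_le_series lambda a b N : 1 < lambda ->
  in_Hs lambda 1 a -> in_Hs lambda 1 b ->
  enstrophy lambda a b N <= Series (fun n => norm_term lambda 1 a (S n))
                            + Series (fun n => norm_term lambda 1 b (S n)).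
Proof.
  intros Hl Ha Hb.
  assert (Hpart : forall u m, in_Hs lambda 1 u ->
    sum_n (fun n => norm_term lambda 1 u (S n)) m
    <= Series (fun n => norm_term lambda 1 u (S n))).
  { intros u m Hu. apply (is_lim_seq_incr_compare
      (sum_n (fun n => norm_term lambda 1 u (S n))) (Series _)).
    - apply Series_correct, Hu.
    - intros n; rewrite sum_n_S.
      assert (H := norm_term_1_ge0 lambda u (S (S n)) Hl); lra. }
  assert (HS : forall m, enstrophy lambda a b (S m) =
    sum_n (fun n => norm_term lambda 1 a (S n)) m
    + sum_n (fun n => norm_term lambda 1 b (S n)) m).
  { unfold enstrophy, energy; induction m as [|m IH].
    - rewrite sum_n_S, !sum_n_0, !norm_term_1 by exact Hl. simpl; ring.
    - rewrite sum_n_S, IH, !sum_n_S, !norm_term_1 by exact Hl. ring. }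
  apply Rle_trans with (enstrophy lambda a b (S N)).
  - apply (sum_n_le_index _ N (S N) (enstrophy_term_ge0 lambda a b)); lia.
  - rewrite HS. apply Rplus_le_compat; now apply Hpart.
Qed.

(** * Existence of strong solutions *)

Lemma is_derive_D_in (D : R -> Prop) (f df : R -> R) (t : R) :
  is_derive f t (df t) -> D_in f df D t.
Proof.
  intros H. apply is_derive_Reals, derivable_pt_lim_D_in in H.
  intros eps Heps; destruct (H eps Heps) as [d [Hd Hlim]].
  exists d; split; [exact Hd|]. intros x [[_ Hx] Hdist].
  apply Hlim; split; [split; [exact I|exact Hx]|exact Hdist].
Qed.

Lemma continuity_pt_continue_in (D : R -> Prop) (f : R -> R) (t : R) :
  continuity_pt f t -> continue_in f D t.
Proof.
  intros H eps Heps; destruct (H eps Heps) as [d [Hd Hlim]].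
  exists d; split; [exact Hd|]. intros x [[_ Hx] Hdist].
  apply Hlim; split; [split; [exact I|exact Hx]|exact Hdist].
Qed.

Lemma truncated_solution_solves lambda nu mu theta M a b j t :
  truncated_solution lambda nu mu theta M a b ->
  weighted_bound lambda M (a t) -> weighted_bound lambda M (b t) ->
  (1 <= j)%nat -> 0 <= t ->
  is_derive (fun s => coord (a s) j) t (rhs_a lambda nu theta (a t) (b t) j) /\
  is_derive (fun s => coord (b s) j) t (rhs_b lambda mu theta (a t) (b t) j).
Proof.
  intros [_ [_ H]] Ha Hb Hj Ht. specialize (H j t Hj Ht).
  rewrite !trunc_id in H by assumption.
  now rewrite rhs_a_nonlin, rhs_b_nonlin.
Qed.

Lemma truncated_solution_is_solution lambda nu mu theta M (D : R -> Prop) a b :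
  truncated_solution lambda nu mu theta M a b ->
  (forall t, D t -> 0 <= t) ->
  (forall t, D t -> in_H (a t) /\ in_H (b t)) ->
  (forall t, D t -> weighted_bound lambda M (a t) /\ weighted_bound lambda M (b t)) ->
  is_solution lambda nu mu theta D a b.
Proof.
  intros Hsol HD HH HM. split; [exact HH|]. intros j Hj.
  exists (fun t => rhs_a lambda nu theta (a t) (b t) j),
    (fun t => rhs_b lambda mu theta (a t) (b t) j).
  assert (Hcont := Hsol); destruct Hcont as [Ha [Hb _]].
  assert (Hlin : forall k (u : R -> sequence), coords_continuous u ->
    continuity (fun t => - k * coord (u t) j)).
  { intros k u Hu t. apply (continuity_pt_scal (fun t => coord (u t) j)), Hu. }
  split; [|split].
  - intros t Ht; split.
    + apply is_derive_D_in, (truncated_solution_solves _ _ mu _ M); auto;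
        now apply HM.
    + apply continuity_pt_continue_in.
      eapply continuity_pt_ext;
        [intros s; symmetry; apply rhs_a_nonlin|].
      apply continuity_pt_plus; [now apply Hlin|now apply nonlin_a_continuity].
  - intros t Ht; split.
    + apply is_derive_D_in, (truncated_solution_solves _ nu _ _ M); auto;
        now apply HM.
    + apply continuity_pt_continue_in.
      eapply continuity_pt_ext;
        [intros s; symmetry; apply rhs_b_nonlin|].
      apply continuity_pt_plus; [now apply Hlin|now apply nonlin_b_continuity].
  - intros t _; now split.
Qed.

(* The truncation level exceeds by one the bound that [enstrophy_le] gives for
   every solution, so it is never reached when [theta <= 2]. *)
Definition enstrophy_cap (lambda c E : R) : R :=
  E * exp (2 * lambda ^ 4 / c * ((E + 1) / (2 * c))).

Lemma le_enstrophy_cap lambda c E : 1 < lambda -> 0 < c -> 0 <= E ->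
  E <= enstrophy_cap lambda c E.
Proof.
  intros Hl Hc HE; unfold enstrophy_cap.
  rewrite <- (Rmult_1_r E) at 1. apply Rmult_le_compat_l; [exact HE|].
  rewrite <- exp_0 at 1. apply exp_le_exp, Rmult_le_pos.
  - apply Rdiv_le_0_compat; [|lra]. assert (H := pow_lt lambda 4 ltac:(lra)); lra.
  - apply Rdiv_le_0_compat; lra.
Qed.

Lemma weighted_bound_global lambda nu mu theta E tau a b :
  let c := Rmin nu mu in
  let Q := enstrophy_cap lambda c E in
  1 < lambda -> 0 < nu -> 0 < mu -> theta <= 2 -> 0 <= E -> 0 < tau ->
  truncated_solution lambda nu mu theta (Q + 2) a b ->
  (forall N, enstrophy lambda (a 0) (b 0) N <= E) ->
  (forall t0, 0 <= t0 ->
    weighted_bound lambda (Q + 1) (a t0) -> weighted_bound lambda (Q + 1) (b t0) ->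
    forall t, t0 <= t <= t0 + tau ->
      weighted_bound lambda (Q + 2) (a t) /\ weighted_bound lambda (Q + 2) (b t)) ->
  forall t, 0 <= t ->
    weighted_bound lambda (Q + 2) (a t) /\ weighted_bound lambda (Q + 2) (b t).
Proof.
  intros c Q Hl Hnu Hmu Ht HE Htau Hsol HE0 Hstep.
  assert (Hc : 0 < c) by now apply Rmin_pos.
  assert (HQ : E <= Q) by now apply le_enstrophy_cap.
  assert (Hiter : forall n t, 0 <= t <= INR n * tau ->
    weighted_bound lambda (Q + 2) (a t) /\ weighted_bound lambda (Q + 2) (b t)).
  { induction n as [|n IH]; intros t Hbd.
    - simpl in Hbd. rewrite Rmult_0_l in Hbd.
      destruct (weighted_bound_of_enstrophy lambda Q (a 0) (b 0) Hl)
        as [H1 H2]; [intros N; eapply Rle_trans; eauto|].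
      apply (Hstep 0 (Rle_refl 0) H1 H2); lra.
    - destruct (Rle_dec t (INR n * tau)) as [Hle|Hgt]; [apply IH; lra|].
      rewrite S_INR in Hbd. assert (Hn := pos_INR n).
      assert (H0 : 0 <= INR n * tau) by (apply Rmult_le_pos; lra).
      destruct (weighted_bound_of_enstrophy lambda Q (a (INR n * tau))
        (b (INR n * tau)) Hl) as [H1 H2].
      + intros N. assert (Hcont := Hsol); destruct Hcont as [Hca [Hcb _]].
        (* By the induction hypothesis the clip is inactive on [[0, n * tau]], so the a priori bound
           applies. It returns the same [Q] for every [n], which restores the full margin before the
           next step. *)
        apply (enstrophy_le lambda nu mu theta c (Q + 2) (INR n * tau)); auto.
        * apply Rmin_l.
        * apply Rmin_r.
        * lra.
        * intros j s Hj Hs. destruct (IH s Hs) as [Hba Hbb].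
          apply (truncated_solution_solves _ _ _ _ (Q + 2)); auto; lra.
        * lra.
      + apply (Hstep _ H0 H1 H2); lra. }
  intros t Ht0.
  destruct (INR_unbounded (t / tau)) as [n Hn].
  apply (Hiter n); split; [exact Ht0|].
  apply (Rmult_lt_compat_r tau) in Hn; [|exact Htau].
  replace (t / tau * tau) with t in Hn by (field; lra). lra.
Qed.

Theorem theorem6p2 :
  forall lambda nu mu delta : R,
    1 < lambda -> 0 < nu -> 0 < mu -> 0 <= delta <= 3 ->
    forall a0 b0 : sequence,
      in_Hs lambda 1 a0 -> in_Hs lambda 1 b0 ->
      exists (T : R) (a b : R -> sequence),
        0 < T /\
        strong_solution lambda nu mu ((5 - delta) / 2) 0 T a b /\
        a 0 = a0 /\ b 0 = b0 /\
        (1 <= delta <= 3 ->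
         global_strong_solution lambda nu mu ((5 - delta) / 2) 0 a b).
Proof.
  intros lambda nu mu delta Hl Hnu Hmu Hdelta a0 b0 Ha0 Hb0.
  set (theta := (5 - delta) / 2).
  assert (Htheta : theta <= 5 / 2) by (unfold theta; lra).
  set (E := Series (fun n => norm_term lambda 1 a0 (S n))
            + Series (fun n => norm_term lambda 1 b0 (S n))).
  assert (HE : forall N, enstrophy lambda a0 b0 N <= E)
    by (intros; now apply enstrophy_le_series).
  assert (HE0 : 0 <= E) by (eapply Rle_trans; [apply enstrophy_ge0|apply (HE 0%nat)]).
  set (c := Rmin nu mu). assert (Hc : 0 < c) by now apply Rmin_pos.
  (* This level is used for every [delta]. The local claim relies on [E <= Q], which places the data
     one unit below the clip; for [delta >= 1] the level is also the global bound. *)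
  set (Q := enstrophy_cap lambda c E).
  assert (HQ : E <= Q) by now apply le_enstrophy_cap.
  destruct (truncated_solution_exists lambda nu mu theta (Q + 2) a0 b0)
    as [a [b [Hsol [Ha Hb]]]]; auto; [lra|].
  rewrite <- Ha in Ha0. rewrite <- Hb in Hb0.
  destruct (weighted_bound_short_time lambda nu mu theta (Q + 2) a b)
    as [tau [Htau Hstep]]; auto; [lra|].
  replace (Q + 2 - 1) with (Q + 1) in Hstep by ring.
  destruct (truncated_solution_decay lambda nu mu theta (Q + 2) a b)
    as [C HC]; auto; [lra|].
  destruct (bounded_in_H1_of_decay lambda C a Hl Ha0) as [Na HNa];
    [intros; now apply HC|].
  destruct (bounded_in_H1_of_decay lambda C b Hl Hb0) as [Nb HNb];
    [intros; now apply HC|].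
  assert (HH : forall t, 0 <= t -> in_H (a t) /\ in_H (b t)).
  { intros t Ht; split; apply (in_Hs_1_in_H lambda); auto;
      [now apply HNa|now apply HNb]. }
  (* The bounds [Na] and [Nb] hold for all [t >= 0], whether or not the clip acts. Being a strong
     solution on [[0, T]] thus reduces to the clip being inactive there. *)
  assert (Hstrong : forall T,
    (forall t, 0 <= t <= T ->
      weighted_bound lambda (Q + 2) (a t) /\ weighted_bound lambda (Q + 2) (b t)) ->
    strong_solution lambda nu mu theta 0 T a b).
  { intros T HT; split; [|split].
    - apply (truncated_solution_is_solution _ _ _ _ (Q + 2)); auto.
      + intros t Ht; apply Ht.
      + intros t Ht; apply HH, Ht.
    - exists Na; intros t Ht; apply HNa, Ht.
    - exists Nb; intros t Ht; apply HNb, Ht. }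
  exists tau, a, b. split; [exact Htau|]. split; [|split; [exact Ha|split; [exact Hb|]]].
  - apply Hstrong; intros t Ht.
    destruct (weighted_bound_of_enstrophy lambda Q (a 0) (b 0) Hl) as [H1 H2].
    { intros N; rewrite Ha, Hb. eapply Rle_trans; [apply HE|exact HQ]. }
    apply (Hstep 0 (Rle_refl 0) H1 H2); lra.
  - intros Hdelta'.
    assert (Hglob : forall t, 0 <= t ->
      weighted_bound lambda (Q + 2) (a t) /\ weighted_bound lambda (Q + 2) (b t)).
    { apply (weighted_bound_global lambda nu mu theta E tau); auto.
      - unfold theta; lra.
      - now rewrite Ha, Hb. }
    split.
    + now apply (truncated_solution_is_solution _ _ _ _ (Q + 2)).
    + intros T _; apply Hstrong; intros t Ht; apply Hglob, Ht.
Qed.
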